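(* Let $K \subset \mathbb{C}$ be a compact convex set with nonempty interior $\operatorname{Int} K$. Then for any $f \in A(K)$ there exists a sequence of near-best polynomials $\{p_n\}_{n=1}^{\infty}$ for $f$ on $K$ such that for every compact set $E \subset \operatorname{Int} K$ there is a constant $c = c(E) > 0$ with $$\limsup_{n \to \infty} \|f - p_n\|_{E}\, e^{cn} = 0.$$
   Context: For a compact set $K\subset\mathbb{C}$, $A(K)$ is the set of complex-valued functions continuous on $K$ and analytic in $\operatorname{Int} K$. $\mathbb{P}_n$ is the set of complex polynomials of degree at most $n$, $\|\cdot\|_{X}$ is the supremum norm over $X$, and $E_n(f) = E_n(f,K) := \inf_{P \in \mathbb{P}_n} \|f - P\|_K$. A sequence of polynomials $\{p_n\}_{n\ge 1}$ with $p_n \in \mathbb{P}_n$ is called near-best (almost optimal) for $f$ on $K$ if there is a fixed constant $C > 1$ (independent of $n$) such that $\|f - p_n\|_K \le C E_n(f)$ for all $n \in \mathbb{N}$. *)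

(* Defs.v *)
From HB Require Import structures.
From mathcomp Require Import all_boot all_order all_algebra.
From mathcomp Require Import complex.
From mathcomp Require Import all_classical all_reals all_analysis.

Set Implicit Arguments.
Unset Strict Implicit.
Unset Printing Implicit Defensive.
Import Order.TTheory GRing.Theory Num.Theory.
Import numFieldNormedType.Exports.
Local Open Scope classical_set_scope.
Local Open Scope ring_scope.

(* [R[i]] has no topology of its own in the libraries. Packaged as a
   [numFieldType] it gets the norm topology that [numFieldNormedType.Exports]
   puts on every numFieldType. A [numClosedFieldType] would get it too, but
   unification in the limit and derivative lemmas then diverges. *)
Definition Cplx (R : realType) : numFieldType := R[i].

(* [Rcomplex R] is [R[i]] as a vector space over [R]: the coefficients of the
   convex combinations range over the real interval [0, 1]. *)
Definition convex_in_C (R : realType) (K : set (Cplx R)) : Prop :=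
  @convex_set R (Rcomplex R) K.

(* Functions are total on C; membership in A(K) depends only on their values
   on K. [derivable f z 1] is over the field C: complex differentiability. *)
Definition in_A (R : realType) (K : set (Cplx R)) (f : Cplx R -> Cplx R) :
    Prop :=
  {within K, continuous f} /\ (forall z, K° z -> derivable f z 1).

(* The norm [`|g z|] lives in C, hence the real part. [sup] is 0 when X is
   empty or g is unbounded on X; the latter does not occur for g continuous on
   a compact X. *)
Definition supnorm (R : realType) (X : set (Cplx R)) (g : Cplx R -> Cplx R) :
    R :=
  sup [set complex.Re `|g z| | z in X].

(* [size P] is one more than the degree, and [size 0 = 0]. *)
Definition poly_deg_le (R : realType) (n : nat) : set {poly Cplx R} :=
  [set P | (size P <= n.+1)%N].

Definition best_approx (R : realType) (K : set (Cplx R))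
    (f : Cplx R -> Cplx R) (n : nat) : R :=
  inf [set supnorm K (fun z => f z - P.[z]) | P in @poly_deg_le R n].

(* Sequences are indexed from 1: the value [p 0%N] is irrelevant. *)
Definition near_best (R : realType) (K : set (Cplx R)) (f : Cplx R -> Cplx R)
    (p : nat -> {poly Cplx R}) : Prop :=
  (forall n, (1 <= n)%N -> poly_deg_le n (p n)) /\
  (exists C : R, 1 < C /\ forall n, (1 <= n)%N ->
     supnorm K (fun z => f z - (p n).[z]) <= C * best_approx K f n).

(* Main.v *)
(** Write [f - P = g] for a near-best polynomial [P] of degree [n]. It is enough
    to find polynomials [Q] of degree at most [n] with [|Q| <= C sup|g|] on [K]
    and [|g - Q|] geometrically small inside [K]; then [P + Q] is still near-best.

    For [zeta] outside [K], a supporting line of [K] and the polynomial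
    [1 + x + x^2], which peaks at the boundary point [0] of a half disc, give a
    polynomial kernel in [z] of degree about [n] that is geometrically close to
    [1 / (zeta - z)] inside [K]. [Q] is the Cauchy integral of [g] over a polygon
    around [K] with this kernel. Inside [K] the claim is immediate. On [K] the
    kernel is compared with [1 / (zeta - z0)], where [z0] is [z] moved inside by
    the order of [1 / n]: the difference is at most a constant times
    [n^-1 / (n^-1 + |zeta - z|)^2], whose integral over the polygon is bounded,
    and the Cauchy integral of [g] with the second kernel is [g z0]. Replacing [g z]
    by [g (lambda z)] with [lambda < 1] close to [1] makes room for the polygon.

    Contour integrals are replaced by dyadic trapezoid sums, which are additive,
    antisymmetric and exact on affine functions; this is all that Goursat's
    bisection argument needs, and no integration theory enters. *)
Require Import Defs.
From mathcomp Require Import all_boot all_order all_algebra.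
From mathcomp Require Import complex qpoly.
From mathcomp Require Import all_classical all_reals all_analysis.
From mathcomp Require Import ring lra zify.

Set Implicit Arguments.
Unset Strict Implicit.
Unset Printing Implicit Defensive.
Import Order.TTheory GRing.Theory Num.Theory.
Import numFieldNormedType.Exports.
Local Open Scope classical_set_scope.
Local Open Scope ring_scope.

(** * Complex numbers with a real-valued modulus *)

(** The obstacle is the boundary of [K]. A single power of the peak polynomial does not decay fast
    enough along the supporting line: on a range of [zeta] beyond distance [1/n] from [z] the kernel
    error can stay of order [1/|zeta - z|], and its integral then costs a factor [log n], which
    would destroy near-optimality. Averaging about [n] consecutive powers gains another factor
    [1/(n |zeta - z|)]; this is what produces an integrable error.

    No contour integral is evaluated. The discrete Cauchy sums are divided by the discrete sum of
    [1/x], which plays the role of [2 pi i]. It hardly changes when the pole moves in [K], because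
    its derivative in the pole is a sum that nearly telescopes, and it is bounded below by the area
    the polygon encloses.

    The polygon, the dilation and the fineness of the sums may all depend on [g] and [n]. The
    constants may not, since [g] is the residual of a near-best polynomial and changes with [n];
    hence every estimate of the contour is tracked down to the inner and outer radius of [K]. *)

Definition nrm {R : realType} (z : Cplx R) : R := complex.Re `|z|.
Definition rc {R : realType} (r : R) : Cplx R := real_complex R r.
Definition cj {R : realType} (z : Cplx R) : Cplx R := conjc z.
Definition re {R : realType} (z : Cplx R) : R := complex.Re z.
Definition im {R : realType} (z : Cplx R) : R := complex.Im z.

Section ComplexNumbers.
Context {R : realType}.
Implicit Types (x y z : Cplx R) (r s : R).

Lemma reD x y : re (x + y) = re x + re y. Proof. by case: x y => a b [c d]. Qed.
Lemma imD x y : im (x + y) = im x + im y. Proof. by case: x y => a b [c d]. Qed.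
Lemma reN x : re (- x) = - re x. Proof. by case: x. Qed.
Lemma imN x : im (- x) = - im x. Proof. by case: x. Qed.
Lemma reM x y : re (x * y) = re x * re y - im x * im y.
Proof. by case: x y => a b [c d]. Qed.
Lemma imM x y : im (x * y) = re x * im y + im x * re y.
Proof. by case: x y => a b [c d]. Qed.
Lemma re_rc r : re (rc r) = r. Proof. by []. Qed.
Lemma im_rc r : im (rc r) = 0. Proof. by []. Qed.
Lemma re1 : re (1 : Cplx R) = 1. Proof. by []. Qed.
Lemma im1 : im (1 : Cplx R) = 0. Proof. by []. Qed.
Lemma re0 : re (0 : Cplx R) = 0. Proof. by []. Qed.
Lemma im0 : im (0 : Cplx R) = 0. Proof. by []. Qed.
Lemma re_cj x : re (cj x) = re x. Proof. by case: x. Qed.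
Lemma im_cj x : im (cj x) = - im x. Proof. by case: x. Qed.

Lemma cplx_eq x y : re x = re y -> im x = im y -> x = y.
Proof. by case: x y => a b [c d] /= -> ->. Qed.

Lemma cjM x y : cj (x * y) = cj x * cj y.
Proof.
by apply: cplx_eq; rewrite ?reM ?imM ?re_cj ?im_cj ?reM ?imM ?re_cj ?im_cj; ring.
Qed.
Lemma cj_rc r : cj (rc r) = rc r.
Proof. by apply: cplx_eq; rewrite ?re_cj ?im_cj ?im_rc ?oppr0. Qed.

Lemma rcD r s : rc (r + s) = rc r + rc s.
Proof. exact: (rmorphD (real_complex R)). Qed.
Lemma rcN r : rc (- r) = - rc r.
Proof. exact: (rmorphN (real_complex R)). Qed.
Lemma rcB r s : rc (r - s) = rc r - rc s.
Proof. exact: (rmorphB (real_complex R)). Qed.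
Lemma rcM r s : rc (r * s) = rc r * rc s.
Proof. exact: (rmorphM (real_complex R)). Qed.
Lemma rc1 : rc 1 = 1 :> Cplx R. Proof. by []. Qed.
Lemma rc0 : rc 0 = 0 :> Cplx R. Proof. by []. Qed.
Lemma rcV r : rc r^-1 = (rc r)^-1.
Proof. exact: (fmorphV (real_complex R)). Qed.
Lemma rc_nat (n : nat) : rc n%:R = n%:R :> Cplx R.
Proof. exact: (rmorph_nat (real_complex R)). Qed.
Lemma rc_eq0 r : (rc r == 0) = (r == 0).
Proof. exact: (fmorph_eq0 (real_complex R)). Qed.

Lemma normE z : `|z| = rc (nrm z).
Proof. by case: z => a b; rewrite /nrm /rc; exact: erefl. Qed.

Lemma lt_rc r s : (rc r < rc s) = (r < s).
Proof. exact: ltcR. Qed.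
Lemma le_rc r s : (rc r <= rc s) = (r <= s).
Proof. exact: lecR. Qed.

Lemma rc_inj r s : rc r = rc s -> r = s.
Proof. by case. Qed.

Lemma nrm_ge0 z : 0 <= nrm z.
Proof. by rewrite -le_rc -normE; exact: normr_ge0. Qed.
Lemma nrm0 : nrm 0 = 0 :> R.
Proof. by apply: rc_inj; rewrite -normE normr0. Qed.
Lemma nrm_eq0 z : (nrm z == 0) = (z == 0).
Proof. by rewrite -rc_eq0 -normE normr_eq0. Qed.
Lemma nrm_gt0 z : (0 < nrm z) = (z != 0).
Proof. by rewrite lt_def nrm_ge0 andbT nrm_eq0. Qed.
Lemma nrm1 : nrm 1 = 1 :> R.
Proof. by apply: rc_inj; rewrite -normE normr1. Qed.
Lemma nrmM x y : nrm (x * y) = nrm x * nrm y.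
Proof. by apply: rc_inj; rewrite rcM -!normE normrM. Qed.
Lemma nrmV x : nrm x^-1 = (nrm x)^-1.
Proof. by apply: rc_inj; rewrite rcV -!normE normfV. Qed.
Lemma nrmX x n : nrm (x ^+ n) = nrm x ^+ n.
Proof. by elim: n => [|n IH]; rewrite ?expr0 ?nrm1 // !exprS nrmM IH. Qed.
Lemma nrmN x : nrm (- x) = nrm x.
Proof. by rewrite /nrm normrN. Qed.
Lemma nrmBC x y : nrm (x - y) = nrm (y - x).
Proof. by rewrite -nrmN opprB. Qed.
Lemma ler_nrmD x y : nrm (x + y) <= nrm x + nrm y.
Proof. by rewrite -le_rc rcD -!normE ler_normD. Qed.
Lemma ler_nrmB x y : nrm (x - y) <= nrm x + nrm y.
Proof. by rewrite -[nrm y]nrmN ler_nrmD. Qed.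
Lemma nrm_tri x y z : nrm (x - z) <= nrm (x - y) + nrm (y - z).
Proof.
have -> : x - z = (x - y) + (y - z) by ring.
exact: ler_nrmD.
Qed.

Lemma nrm_sqr z : nrm z ^+ 2 = re z ^+ 2 + im z ^+ 2.
Proof.
case: z => a b; rewrite /nrm /re /im /= sqr_sqrtr //.
by rewrite addr_ge0 ?sqr_ge0.
Qed.

Lemma nrm_rc r : nrm (rc r) = `|r|.
Proof.
apply/eqP; rewrite -(@eqrXn2 _ 2) ?nrm_ge0 ?normr_ge0 //.
by rewrite nrm_sqr re_rc im_rc expr0n addr0 real_normK // num_real.
Qed.

Lemma nrm_rc_ge0 r : 0 <= r -> nrm (rc r) = r.
Proof. by move=> r0; rewrite nrm_rc ger0_norm. Qed.

Lemma nrm_nat (n : nat) : nrm (n%:R : Cplx R) = n%:R.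
Proof. by rewrite -rc_nat nrm_rc_ge0. Qed.

Lemma nrm_cj z : nrm (cj z) = nrm z.
Proof.
apply/eqP; rewrite -(@eqrXn2 _ 2) ?nrm_ge0 //.
by rewrite !nrm_sqr re_cj im_cj sqrrN.
Qed.

Lemma abs_re_le z : `|re z| <= nrm z.
Proof.
rewrite -(@ler_pXn2r _ 2) ?nnegrE ?nrm_ge0 // nrm_sqr real_normK ?num_real //.
by rewrite lerDl sqr_ge0.
Qed.
Lemma abs_im_le z : `|im z| <= nrm z.
Proof.
rewrite -(@ler_pXn2r _ 2) ?nnegrE ?nrm_ge0 // nrm_sqr real_normK ?num_real //.
by rewrite lerDr sqr_ge0.
Qed.
Lemma re_le z : re z <= nrm z.
Proof. exact: le_trans (ler_norm _) (abs_re_le z). Qed.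
Lemma im_le z : im z <= nrm z.
Proof. exact: le_trans (ler_norm _) (abs_im_le z). Qed.

Lemma mul_cj z : cj z * z = rc (nrm z ^+ 2).
Proof.
apply: cplx_eq; rewrite ?reM ?imM !re_cj !im_cj ?re_rc ?im_rc ?nrm_sqr; ring.
Qed.

End ComplexNumbers.

Lemma nrm_sum {R : realType} (I : Type) (s : seq I) (F : I -> Cplx R) :
  nrm (\sum_(i <- s) F i) <= \sum_(i <- s) nrm (F i).
Proof.
elim: s => [|i s IH]; first by rewrite !big_nil nrm0.
by rewrite !big_cons; apply: (le_trans (ler_nrmD _ _)); rewrite lerD2l.
Qed.

(** * Neighbourhoods and compactness in terms of the real modulus *)

Section Topology.
Context {R : realType}.
Implicit Types (K : set (Cplx R)) (x y z : Cplx R).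

Lemma cplx_gt0 (e : Cplx R) : 0 < e -> exists2 r : R, 0 < r & e = rc r.
Proof.
case: e => a b; rewrite ltcE => /andP[/eqP /= -> a0].
by exists a.
Qed.

Lemma nbhs_nrmP z (A : set (Cplx R)) :
  nbhs z A <-> exists2 d : R, 0 < d & forall y, nrm (y - z) < d -> A y.
Proof.
split.
  move=> /nbhs_normP[e /= e0 eA].
  have [r r0 re] := cplx_gt0 e0.
  exists r => // y yz; apply: eA => /=.
  by rewrite re normE lt_rc nrmBC.
move=> [d d0 dA]; apply/nbhs_normP.
exists (rc d) => /=; first by rewrite -rc0 lt_rc.
by move=> y /=; rewrite normE lt_rc nrmBC => /dA.
Qed.

Lemma interior_nrmP K z :
  K° z <-> exists2 d : R, 0 < d & forall y, nrm (y - z) < d -> K y.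
Proof. exact: nbhs_nrmP. Qed.

(** Compactness in the form used throughout: local thresholds have a common one. The near-covering
    property with the filter [\oo] takes the place of a finite subcover and the maximum of its
    thresholds. *)
Lemma compact_nat_uniform K (P : nat -> Cplx R -> Prop) : compact K ->
  (forall m n z, (m <= n)%N -> P m z -> P n z) ->
  (forall z, K z -> exists n, exists2 d : R, 0 < d &
     forall y, K y -> nrm (y - z) < d -> P n y) ->
  exists n, forall z, K z -> P n z.
Proof.
move=> /compact_near_coveringP/near_covering_withinP cK Pmon locP.
have [] := cK nat \oo P _ _.
  move=> z /locP[n [d d0 dP]].
  exists ([set y | nrm (y - z) < d], [set m | (n <= m)%N]) => /=.
    split; last by exists n.
    by apply/nbhs_nrmP; exists d.
  by move=> [y m] /= [yz nm] Ky; apply: Pmon nm _; exact: dP.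
by move=> n _ nP; exists n => z; apply: (nP n) => /=.
Qed.

End Topology.

(** * Trapezoid sums and Goursat's lemma *)

(** The parameter [m] is kept to the end: no limit is taken, estimates hold for every [m] or for all
    large [m]. *)
Fixpoint segint {R : realType} (m : nat) (a b : Cplx R)
    (phi : Cplx R -> Cplx R) : Cplx R :=
  if m is m'.+1 then
    segint m' a ((a + b) / 2) phi + segint m' ((a + b) / 2) b phi
  else (b - a) * (phi a + phi b) / 2.

Definition triint {R : realType} (m : nat) (a b c : Cplx R)
    (phi : Cplx R -> Cplx R) : Cplx R :=
  segint m a b phi + segint m b c phi + segint m c a phi.

(** The nodes of a trapezoid sum arise from the end points by repeated midpoints, so this is the
    form of convexity that locates them. *)
Definition midclosed {R : realType} (L : set (Cplx R)) :=
  forall a b, L a -> L b -> L ((a + b) / 2).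

Section Trapezoid.
Context {R : realType}.
Implicit Types (a b c z : Cplx R) (phi psi : Cplx R -> Cplx R).

Lemma nrm_half z : nrm (z / 2) = nrm z / 2.
Proof. by rewrite nrmM nrmV nrm_nat. Qed.

Lemma segint_ext (L : set (Cplx R)) phi psi m a b : midclosed L ->
  (forall x, L x -> phi x = psi x) -> L a -> L b ->
  segint m a b phi = segint m a b psi.
Proof.
move=> Lm e; elim: m a b => [|m IH] a b La Lb /=; first by rewrite !e.
by rewrite !IH //; exact: Lm.
Qed.

Lemma segintD phi psi m a b :
  segint m a b (fun x => phi x + psi x) = segint m a b phi + segint m a b psi.
Proof.
elim: m a b => [|m IH] a b /=; first by field.
by rewrite !IH addrACA.
Qed.

Lemma segintZ k phi m a b :
  segint m a b (fun x => k * phi x) = k * segint m a b phi.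
Proof.
elim: m a b => [|m IH] a b /=; first by field.
by rewrite !IH mulrDr.
Qed.

Lemma segintB phi psi m a b :
  segint m a b (fun x => phi x - psi x) = segint m a b phi - segint m a b psi.
Proof.
elim: m a b => [|m IH] a b /=; first by field.
by rewrite !IH opprD addrACA.
Qed.

Lemma segint_rev phi m a b : segint m b a phi = - segint m a b phi.
Proof.
elim: m a b => [|m IH] a b /=; first by field.
rewrite [b + a]addrC (IH a) (IH _ b) opprD; exact: addrC.
Qed.

Lemma segint_affine k l m a b :
  segint m a b (fun x => k + l * x) = k * (b - a) + l * (b ^+ 2 - a ^+ 2) / 2.
Proof.
elim: m a b => [|m IH] a b /=; first by field.
by rewrite !IH; field.
Qed.

Lemma ler_segint (L : set (Cplx R)) (B : R) phi m a b : midclosed L ->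
  (forall x, L x -> nrm (phi x) <= B) -> L a -> L b ->
  nrm (segint m a b phi) <= nrm (b - a) * B.
Proof.
move=> Lm LB; elim: m a b => [|m IH] a b La Lb /=.
  rewrite nrm_half nrmM -mulrA ler_wpM2l ?nrm_ge0 //.
  have := ler_nrmD (phi a) (phi b); have := LB a La; have := LB b Lb; lra.
have Lc := Lm _ _ La Lb.
apply: (le_trans (ler_nrmD _ _)).
apply: (le_trans (lerD (IH _ _ La Lc) (IH _ _ Lc Lb))).
have -> : (a + b) / 2 - a = (b - a) / 2 by field.
have -> : b - (a + b) / 2 = (b - a) / 2 by field.
by rewrite nrm_half; lra.
Qed.

(** Each inner edge is run through twice in opposite directions and cancels; the halves of the outer
    edges are the sums of level [m] that make up level [m.+1]. *)
Lemma triint_split phi m a b c :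
  triint m.+1 a b c phi =
  triint m a ((a + b) / 2) ((c + a) / 2) phi +
  triint m b ((b + c) / 2) ((a + b) / 2) phi +
  triint m c ((c + a) / 2) ((b + c) / 2) phi +
  triint m ((a + b) / 2) ((b + c) / 2) ((c + a) / 2) phi.
Proof.
rewrite /triint /=.
rewrite (segint_rev _ _ ((c + a) / 2) ((a + b) / 2)).
rewrite (segint_rev _ _ ((a + b) / 2) ((b + c) / 2)).
rewrite (segint_rev _ _ ((b + c) / 2) ((c + a) / 2)).
ring.
Qed.

Lemma triint_affine k l m a b c : triint m a b c (fun x => k + l * x) = 0.
Proof. by rewrite /triint !segint_affine; field. Qed.

Definition perim a b c : R := nrm (b - a) + nrm (c - b) + nrm (a - c).

Lemma perim_ge0 a b c : 0 <= perim a b c.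
Proof. by rewrite !addr_ge0 ?nrm_ge0. Qed.

Lemma perim_half1 a b c : perim a ((a + b) / 2) ((c + a) / 2) = perim a b c / 2.
Proof.
rewrite /perim.
have -> : (a + b) / 2 - a = (b - a) / 2 by field.
have -> : (c + a) / 2 - (a + b) / 2 = (c - b) / 2 by field.
have -> : a - (c + a) / 2 = (a - c) / 2 by field.
by rewrite !nrm_half; field.
Qed.

Lemma perim_half2 a b c : perim b ((b + c) / 2) ((a + b) / 2) = perim a b c / 2.
Proof. by rewrite perim_half1 /perim; field. Qed.

Lemma perim_half3 a b c : perim c ((c + a) / 2) ((b + c) / 2) = perim a b c / 2.
Proof. by rewrite perim_half1 /perim; field. Qed.

Lemma perim_half4 a b c :
  perim ((a + b) / 2) ((b + c) / 2) ((c + a) / 2) = perim a b c / 2.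
Proof.
rewrite /perim.
have -> : (b + c) / 2 - (a + b) / 2 = - ((a - c) / 2) by field.
have -> : (c + a) / 2 - (b + c) / 2 = - ((b - a) / 2) by field.
have -> : (a + b) / 2 - (c + a) / 2 = - ((c - b) / 2) by field.
by rewrite !nrmN !nrm_half; field.
Qed.

Lemma ler_triint (L : set (Cplx R)) (B : R) phi m a b c : midclosed L ->
  (forall x, L x -> nrm (phi x) <= B) -> L a -> L b -> L c ->
  nrm (triint m a b c phi) <= perim a b c * B.
Proof.
move=> Lm LB La Lb Lc; rewrite /triint /perim !mulrDl.
apply: (le_trans (ler_nrmD _ _)); apply: lerD; last exact: (ler_segint _ Lm LB).
apply: (le_trans (ler_nrmD _ _)).
by apply: lerD; exact: (ler_segint _ Lm LB).
Qed.

Lemma midclosedI (L M : set (Cplx R)) :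
  midclosed L -> midclosed M -> midclosed (L `&` M).
Proof. by move=> Lm Mm a b [La Ma] [Lb Mb]; split; [exact: Lm|exact: Mm]. Qed.

Lemma midclosed_ball p (r : R) : midclosed [set x | nrm (x - p) <= r].
Proof.
move=> a b /= ar br.
have -> : (a + b) / 2 - p = ((a - p) + (b - p)) / 2 by field.
by rewrite nrm_half; have := ler_nrmD (a - p) (b - p); lra.
Qed.

Lemma midclosed_half (w : Cplx R) (r : R) : midclosed [set x | r <= re (w * x)].
Proof.
move=> a b /= ar br.
have -> : w * ((a + b) / 2) = rc (2^-1) * (w * a + w * b).
  by rewrite rcV rc_nat; field.
by rewrite reM re_rc im_rc reD; lra.
Qed.

End Trapezoid.

Section Goursat.
Context {R : realType}.
Implicit Types (a b c z p : Cplx R) (g : Cplx R -> Cplx R) (L : set (Cplx R)).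

(** Complex differentiability with the denominator cleared, so that [y = p] is no exception. *)
Definition cdiff g p := exists d : Cplx R, forall e : R, 0 < e ->
  exists2 r : R, 0 < r & forall y, nrm (y - p) < r ->
    nrm (g y - g p - d * (y - p)) <= e * nrm (y - p).

Lemma cdiffP g p : derivable g p 1 <-> cdiff g p.
Proof.
split.
  move=> /cvg_ex[d dP]; exists d => e e0.
  have /nbhs_nrmP[r r0 rP] : \forall h \near (0 : Cplx R), h != 0 ->
      `|d - h^-1 *: ((g \o shift p) (h *: 1) - g p)| < rc e.
    by move/cvgrPdist_lt: dP => /(_ (rc e)); rewrite -rc0 lt_rc => /(_ e0).
  exists r => // y yr.
  have [->|yp] := eqVneq y p; first by rewrite !subrr mulr0 subr0 nrm0 mulr0.
  have h0 : y - p != 0 by rewrite subr_eq0.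
  have := rP (y - p); rewrite subr0 => /(_ yr h0).
  rewrite normE lt_rc => /ltW.
  rewrite /= -[_ *: 1]/(_ * 1) -[_ *: (_ - _)]/(_ * (_ - _)) mulr1 subrK => H.
  have -> : g y - g p - d * (y - p) = - ((y - p) * (d - (y - p)^-1 * (g y - g p))).
    by field.
  by rewrite nrmN nrmM mulrC ler_wpM2r ?nrm_ge0.
move=> [d dP]; apply/cvg_ex; exists d; apply/cvgrPdist_le => e /cplx_gt0[r r0 ->].
have [s s0 sP] := dP r r0.
apply/nbhs_nrmP; exists s => // h; rewrite subr0 => hs h0.
rewrite normE le_rc.
rewrite /= -[_ *: 1]/(_ * 1) -[_ *: (_ - _)]/(_ * (_ - _)) mulr1.
have := sP (h + p); rewrite addrK => /(_ hs) H.
rewrite -(@ler_pM2l _ (nrm h)) ?nrm_gt0 // -nrmM mulrC [nrm h * r]mulrC.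
rewrite -nrmN; apply: le_trans H; rewrite le_eqVlt; apply/orP; left; apply/eqP.
by congr nrm; field.
Qed.

Lemma cdiff_cont g p : cdiff g p -> forall e : R, 0 < e ->
  exists2 r : R, 0 < r & forall y, nrm (y - p) < r -> nrm (g y - g p) <= e.
Proof.
move=> [d /(_ 1 ltr01)[r r0 rP]] e e0.
have B0 : 0 < 1 + nrm d by have := nrm_ge0 d; lra.
exists (Num.min r (e / (1 + nrm d))).
  by rewrite lt_min r0 divr_gt0.
move=> y; rewrite lt_min => /andP[/rP yr ye].
have -> : g y - g p = (g y - g p - d * (y - p)) + d * (y - p) by ring.
apply: (le_trans (ler_nrmD _ _)); rewrite nrmM.
move: ye; rewrite ltr_pdivlMr // => ye; nra.
Qed.

End Goursat.

Lemma exists_div_exp2_lt {R : realType} (x e : R) : 0 <= x -> 0 < e ->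
  exists k, x / 2 ^+ k < e.
Proof.
move=> x0 e0; exists (Num.bound (x / e)).
rewrite ltr_pdivrMr ?exprn_gt0 // mulrC -ltr_pdivrMr //.
apply: (lt_le_trans (archi_boundP _)); first by rewrite divr_ge0 // ltW.
by rewrite -natrX ler_nat ltnW // ltn_expl.
Qed.

Section Goursat.
Context {R : realType}.
Implicit Types (a b c z p : Cplx R) (g : Cplx R -> Cplx R) (L : set (Cplx R)).

Lemma locally_bounded_compact L (phi : Cplx R -> Cplx R) : compact L ->
  (forall z, L z -> exists B : R, exists2 r : R, 0 < r &
    forall y, L y -> nrm (y - z) < r -> nrm (phi y) <= B) ->
  exists2 B : R, 0 < B & forall z, L z -> nrm (phi z) <= B.
Proof.
move=> Lc locB.
have [||n nP] := @compact_nat_uniform _ L (fun n z => nrm (phi z) <= n%:R) Lc.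
- by move=> m n z mn /le_trans; apply; rewrite ler_nat.
- move=> z /locB[B [r r0 rP]]; exists (Num.bound `|B|); exists r => // y Ly yz.
  apply: (le_trans (rP y Ly yz)); apply: (le_trans (ler_norm _)).
  by apply/ltW/archi_boundP.
- exists (n%:R + 1) => [|z /nP]; last by lra.
  by rewrite ltr_wpDl.
Qed.

Lemma compact_cluster_seq L (u : nat -> Cplx R) : compact L ->
  (forall n, L (u n)) ->
  exists2 p, L p & forall (e : R) n, 0 < e ->
    exists2 k, (n <= k)%N & nrm (u k - p) < e.
Proof.
move=> Lc Lu; apply: contrapT => nex.
have [||n nP] := @compact_nat_uniform _ L
    (fun n y => forall k, (n <= k)%N -> u k <> y) Lc.
- by move=> m n z mn H k nk; apply: H; exact: leq_trans nk.
- move=> z Lz; apply: contrapT => H; apply: nex; exists z => // e n e0.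
  apply: contrapT => H'; apply: H; exists n; exists e => // y Ly yz k nk uky.
  by apply: H'; exists k => //; rewrite uky.
- exact: (nP (u n) (Lu n) n (leqnn n)).
Qed.

(** Goursat's bisection. Each [good] triangle has its own threshold for [m]; if the four children
    are good, the parent is good from one level above the largest threshold on, since perimeters
    halve and their squares quarter. A bad triangle therefore starts a sequence of bad ones
    shrinking to a point [p], where differentiability contradicts badness. *)
Lemma goursat_perim L g a b c : compact L -> midclosed L ->
  (forall p, L p -> cdiff g p) -> L a -> L b -> L c ->
  forall e : R, 0 < e -> exists M, forall m, (M <= m)%N ->
    nrm (triint m a b c g) <= e * perim a b c ^+ 2.
Proof.
move=> Lc Lm gd La Lb Lc' e e0.
pose tri := (Cplx R * Cplx R * Cplx R)%type.
pose pe (T : tri) : R := perim T.1.1 T.1.2 T.2.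
pose good (T : tri) := exists M, forall m, (M <= m)%N ->
    nrm (triint m T.1.1 T.1.2 T.2 g) <= e * pe T ^+ 2.
pose bad T := [/\ L T.1.1, L T.1.2, L T.2 & ~ good T].
suff : ~ bad (a, b, c) by move=> H; apply: contrapT => ng; apply: H; split.
have step (T : tri) : exists T' : tri, bad T ->
    [/\ bad T', pe T' = pe T / 2 & nrm (T'.1.1 - T.1.1) <= pe T].
  case: T => [[x y] z].
  have [[Lx Ly Lz ng]|nb] := pselect (bad (x, y, z)); last by exists (x, y, z).
  rewrite /= in Lx Ly Lz.
  have Lxy := Lm _ _ Lx Ly; have Lyz := Lm _ _ Ly Lz; have Lzx := Lm _ _ Lz Lx.
  apply: contrapT => /forallNP H; apply: ng.
  have pxy : nrm (y - x) <= pe (x, y, z).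
    by rewrite /pe /perim /= -addrA lerDl addr_ge0 ?nrm_ge0.
  have pxz : nrm (z - x) <= pe (x, y, z).
    by rewrite /pe /perim /= nrmBC lerDr addr_ge0 ?nrm_ge0.
  have child (x' y' z' : Cplx R) : L x' -> L y' -> L z' ->
      perim x' y' z' = perim x y z / 2 -> nrm (x' - x) <= pe (x, y, z) ->
      good (x', y', z').
    move=> Lx' Ly' Lz' pp np; apply: contrapT => ng'.
    by apply: (H (x', y', z')) => _; split.
  have [|M1 P1] := child _ _ _ Lx Lxy Lzx (perim_half1 x y z).
    by rewrite subrr nrm0 perim_ge0.
  have [|M2 P2] := child _ _ _ Ly Lyz Lxy (perim_half2 x y z).
    exact: pxy.
  have [|M3 P3] := child _ _ _ Lz Lzx Lyz (perim_half3 x y z).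
    exact: pxz.
  have [|M4 P4] := child _ _ _ Lxy Lyz Lzx (perim_half4 x y z).
    have -> : (x + y) / 2 - x = (y - x) / 2 by field.
    by rewrite nrm_half; have := nrm_ge0 (y - x); lra.
  exists (maxn (maxn M1 M2) (maxn M3 M4)).+1 => -[//|m].
  rewrite ltnS !geq_max => /andP[/andP[m1 m2] /andP[m3 m4]].
  rewrite triint_split.
  have := P1 m m1; have := P2 m m2; have := P3 m m3; have := P4 m m4.
  rewrite /pe /= (perim_half1 x y z) (perim_half2 x y z).
  rewrite (perim_half3 x y z) (perim_half4 x y z) => q4 q3 q2 q1.
  apply: (le_trans (ler_nrmD _ _)).
  apply: (le_trans (lerD (le_trans (ler_nrmD _ _)
    (lerD (ler_nrmD _ _) (lexx _))) (lexx _))).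
  apply: (le_trans (lerD (lerD (lerD q1 q2) q3) q4)).
  by rewrite le_eqVlt; apply/orP; left; apply/eqP; field.
have [nx nxP] := choice step.
move=> bad0; pose T k := iter k nx (a, b, c).
have badT k : bad (T k) by elim: k => // k /nxP[].
have peS k : pe (T k.+1) = pe (T k) / 2 by have [] := nxP _ (badT k).
have peT k : pe (T k) = perim a b c / 2 ^+ k.
  elim: k => [|k IH]; first by rewrite expr0 divr1.
  by rewrite peS IH exprS invfM; ring.
pose u k := (T k).1.1.
have uS k : nrm (u k.+1 - u k) <= pe (T k) by have [] := nxP _ (badT k).
(* The geometric series of the perimeters, in a telescoped form that closes under induction. *)
have uD k j : nrm (u (k + j)%N - u k) <= 2 * pe (T k) - 2 * pe (T (k + j)%N).
  elim: j => [|j IH]; first by rewrite addn0 !subrr nrm0.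
  have := nrm_tri (u (k + j.+1)%N) (u (k + j)%N) (u k).
  have := uS (k + j)%N; rewrite addnS peS; lra.
have Lu k : L (u k) by have [] := badT k.
have [p Lp pP] := compact_cluster_seq Lc Lu.
have pu k : nrm (u k - p) <= 2 * pe (T k).
  apply/ler_addgt0Pr => d d0.
  have [j kj jd] := pP d k d0.
  have := nrm_tri (u k) (u j) p; rewrite (nrmBC (u k) (u j)).
  have := uD k (j - k)%N; rewrite subnKC // => H.
  have := perim_ge0 (T j).1.1 (T j).1.2 (T j).2; rewrite -/(pe (T j)); lra.
have [d dP] := gd p Lp.
have [r r0 rP] := dP (e / 3) (divr_gt0 e0 (ltr0n _ 3)).
have [k kP] := exists_div_exp2_lt (perim_ge0 a b c) (divr_gt0 r0 (ltr0n _ 3)).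
rewrite -peT in kP.
have [] := badT k; move: (pu k) kP; rewrite /u /good.
case: (T k) => [[x y] z] /=; rewrite /pe /= => px pr Lx Ly Lz; apply.
set P := perim x y z in px pr *.
have P0 : 0 <= P by exact: perim_ge0.
exists 0%N => m _.
(* The tangent map [A + d * v] has zero triangle sum and can be subtracted. All nodes lie within [P]
   of [x], hence within [3 * P < r] of [p], where the remainder is at most [e / 3] times the
   distance to [p]. *)
pose A := g p - d * p.
have -> : triint m x y z g = triint m x y z (fun v => g v - (A + d * v)).
  rewrite -[LHS]subr0 -(triint_affine A d m x y z) /triint !segintB; ring.
have -> : e * P ^+ 2 = P * (e / 3 * (3 * P)) by field.
have bx : [set v | nrm (v - x) <= P] x by rewrite /= subrr nrm0.
have by' : [set v | nrm (v - x) <= P] y.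
  by rewrite /= /P /perim -addrA lerDl addr_ge0 ?nrm_ge0.
have bz : [set v | nrm (v - x) <= P] z.
  by rewrite /= /P /perim (nrmBC z x) lerDr addr_ge0 ?nrm_ge0.
apply: (ler_triint _ (@midclosed_ball _ x P)) => // v /= vx.
have vp : nrm (v - p) <= 3 * P by have := nrm_tri v x p; lra.
have -> : g v - (A + d * v) = g v - g p - d * (v - p) by rewrite /A; ring.
apply: (le_trans (rP v _)); first by lra.
by rewrite ler_wpM2l // divr_ge0 // ltW.
Qed.

Lemma goursat L g a b c : compact L -> midclosed L ->
  (forall p, L p -> cdiff g p) -> L a -> L b -> L c ->
  forall e : R, 0 < e -> exists M, forall m, (M <= m)%N ->
    nrm (triint m a b c g) <= e.
Proof.
move=> Lc Lm gd La Lb Lc' e e0; set P := perim a b c.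
have P1 : 0 < P ^+ 2 + 1 by rewrite ltr_wpDl ?sqr_ge0.
have [M MP] := goursat_perim Lc Lm gd La Lb Lc' (divr_gt0 e0 P1).
exists M => m /MP /le_trans; apply; rewrite mulrAC ler_pdivrMr //.
by rewrite ler_wpM2l ?(ltW e0) // lerDl.
Qed.

(** At [x = z] the value is [0] by the convention for division, not the derivative of [g]. So the
    quotient is differentiable away from [z] but in general only bounded near [z], and triangles
    with a corner at [z] need their own argument. *)
Definition diffquo g z := fun x => (g x - g z) / (x - z).

Lemma cdiff_diffquo g z p : p != z -> cdiff g p -> cdiff (diffquo g z) p.
Proof.
move=> pz [d dP]; set w := p - z; set a := g p - g z.
have w0 : w != 0 by rewrite subr_eq0.
have nw : 0 < nrm w by rewrite nrm_gt0.
exists ((w * d - a) / w ^+ 2) => e e0; set A := nrm (w * d - a).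
have A0 : 0 <= A by exact: nrm_ge0.
have [r r0 rP] := dP (e * nrm w / 4) (divr_gt0 (mulr_gt0 e0 nw) (ltr0n _ 4)).
have s0 : 0 < e * nrm w ^+ 3 / (4 * (A + 1)).
  by rewrite divr_gt0 ?mulr_gt0 ?exprn_gt0 // ltr_wpDl.
(* The three radii control the remainder [rho] of [g], the denominator ([|w + h| >= |w| / 2]) and
   the term in [h ^+ 2]. The two terms of the numerator take half of the allowed error each. *)
exists (Num.min r (Num.min (nrm w / 2) (e * nrm w ^+ 3 / (4 * (A + 1))))).
  by rewrite !lt_min r0 s0 divr_gt0.
move=> y; rewrite !lt_min => /and3P[/rP yr yw ys].
set h := y - p in yr yw ys *; set rho := g y - g p - d * h in yr.
have wh : nrm w / 2 <= nrm (w + h).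
  have -> : nrm w = nrm ((w + h) - h) by congr nrm; ring.
  have := ler_nrmB (w + h) h.
  have e' : (w + h) - h = w by ring.
  by rewrite e'; lra.
have nwh : 0 < nrm (w + h) by apply: lt_le_trans wh; rewrite divr_gt0.
have wh0 : w + h != 0 by rewrite -nrm_gt0.
have -> : diffquo g z y - diffquo g z p - (w * d - a) / w ^+ 2 * h =
    (w ^+ 2 * rho - (w * d - a) * h ^+ 2) / (w ^+ 2 * (w + h)).
  have -> : diffquo g z y = (a + d * h + rho) / (w + h).
    by rewrite /diffquo /rho /a /w /h; congr (_ / _); ring.
  have -> : diffquo g z p = a / w by [].
  by field; rewrite wh0.
rewrite nrmM nrmV (nrmM (w ^+ 2) (w + h)) (nrmX w 2).
rewrite ler_pdivrMr ?mulr_gt0 ?exprn_gt0 //.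
apply: (le_trans (ler_nrmB _ _)).
rewrite (nrmM (w ^+ 2)) (nrmM (w * d - a)) (nrmX w 2) (nrmX h 2) -/A.
have nh : 0 <= nrm h by exact: nrm_ge0.
have H1 : nrm w ^+ 2 * nrm rho <= nrm w ^+ 2 * (e * nrm w / 4 * nrm h).
  by rewrite ler_wpM2l // sqr_ge0.
have H2 : A * nrm h ^+ 2 <= e * nrm w ^+ 3 / 4 * nrm h.
  rewrite expr2 mulrA ler_wpM2r //.
  move: ys; rewrite ltr_pdivlMr ?mulr_gt0 ?ltr_wpDl // => ys.
  by move: nh A0 ys; nra.
have H3 : e * nrm h * (nrm w ^+ 2 * (nrm w / 2)) <=
    e * nrm h * (nrm w ^+ 2 * nrm (w + h)).
  apply: ler_wpM2l; first by rewrite mulr_ge0 // ltW.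
  by apply: ler_wpM2l => //; rewrite exprn_ge0 // ltW.
apply: (le_trans (lerD H1 H2)); apply: le_trans H3.
by rewrite le_eqVlt; apply/orP; left; apply/eqP; field.
Qed.

Lemma cdiffB g1 g2 p : cdiff g1 p -> cdiff g2 p -> cdiff (fun x => g1 x - g2 x) p.
Proof.
move=> [d1 H1] [d2 H2]; exists (d1 - d2) => e e0.
have e20 : 0 < e / 2 by rewrite divr_gt0.
have [r1 r10 P1] := H1 _ e20; have [r2 r20 P2] := H2 _ e20.
exists (Num.min r1 r2); first by rewrite lt_min r10.
move=> y; rewrite lt_min => /andP[/P1 y1 /P2 y2].
have -> : g1 y - g2 y - (g1 p - g2 p) - (d1 - d2) * (y - p) =
  (g1 y - g1 p - d1 * (y - p)) - (g2 y - g2 p - d2 * (y - p)) by ring.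
by apply: (le_trans (ler_nrmB _ _)); lra.
Qed.

Lemma cdiff_dilate g (k p : Cplx R) : k != 0 -> cdiff g (k * p) ->
  cdiff (fun x => g (k * x)) p.
Proof.
move=> k0 [d H]; have nk : 0 < nrm k by rewrite nrm_gt0.
exists (d * k) => e e0.
have [r r0 P] := H (e / nrm k) (divr_gt0 e0 nk).
exists (r / nrm k) => [|y]; first by rewrite divr_gt0.
rewrite ltr_pdivlMr // mulrC -nrmM mulrBr => /P.
rewrite -mulrBr nrmM mulrA mulfVK ?gt_eqF // => H'.
by have -> : d * k * (y - p) = d * (k * (y - p)) by ring.
Qed.

Lemma horner_bounded (P : {poly Cplx R}) p (r : R) : 0 <= r ->
  exists2 B : R, 0 <= B & forall y, nrm (y - p) <= r -> nrm P.[y] <= B.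
Proof.
move=> r0; elim/poly_ind: P => [|P c [B B0 BP]].
  by exists 0 => // y _; rewrite horner0 nrm0.
exists (B * (nrm p + r) + nrm c).
  by rewrite addr_ge0 ?mulr_ge0 ?addr_ge0 ?nrm_ge0.
move=> y yr; rewrite hornerMXaddC; apply: (le_trans (ler_nrmD _ _)).
rewrite lerD2r nrmM ler_pM ?nrm_ge0 ?BP //.
have -> : nrm y = nrm (p + (y - p)) by congr nrm; ring.
by apply: (le_trans (ler_nrmD _ _)); rewrite lerD2l.
Qed.

Lemma horner_taylor1 (P : {poly Cplx R}) p :
  exists Q : {poly Cplx R}, forall y, P.[y] = P.[p] + Q.[y] * (y - p).
Proof.
have /factor_theorem[Q PQ] : root (P - P.[p]%:P) p.
  by rewrite rootE !hornerE subrr.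
exists Q => y; have /(congr1 (fun S : {poly _} => S.[y])) := PQ.
by rewrite !hornerE => <-; ring.
Qed.

Lemma cdiff_horner (P : {poly Cplx R}) p : cdiff (fun x => P.[x]) p.
Proof.
have [Q PQ] := horner_taylor1 P p; have [S QS] := horner_taylor1 Q p.
have [B B0 BP] := horner_bounded S p ler01.
exists Q.[p] => e e0; have B1 : 0 < B + 1 by rewrite ltr_wpDl.
exists (Num.min 1 (e / (B + 1))); first by rewrite lt_min ltr01 divr_gt0.
move=> y; rewrite lt_min ltr_pdivlMr // => /andP[/ltW/BP y1 ye].
have -> : P.[y] - P.[p] - Q.[p] * (y - p) = S.[y] * (y - p) * (y - p).
  by rewrite PQ QS; ring.
rewrite 2!nrmM ler_wpM2r ?nrm_ge0 //.
have := nrm_ge0 (y - p); nra.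
Qed.

Lemma diffquo_bounded L g z : compact L -> L z ->
  (forall p, L p -> cdiff g p) ->
  exists2 B : R, 0 < B & forall x, L x -> nrm (diffquo g z x) <= B.
Proof.
move=> Lc Lz gd; apply: locally_bounded_compact => // p Lp.
have [->|pz] := eqVneq p z.
  have [d /(_ 1 ltr01)[r r0 rP]] := gd z Lz.
  exists (1 + nrm d); exists r => // y _ /rP.
  have [->|yz] := eqVneq y z.
    by rewrite /diffquo !subrr mul0r nrm0 addr_ge0 ?nrm_ge0.
  have nz : 0 < nrm (y - z) by rewrite nrm_gt0 subr_eq0.
  rewrite /diffquo nrmM nrmV ler_pdivrMr // => H.
  have -> : g y - g z = (g y - g z - d * (y - z)) + d * (y - z) by ring.
  by apply: (le_trans (ler_nrmD _ _)); rewrite nrmM mulrDl lerD2r.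
have [r r0 rP] := cdiff_cont (cdiff_diffquo pz (gd p Lp)) ltr01.
exists (1 + nrm (diffquo g z p)); exists r => // y _ /rP H.
have -> : diffquo g z y = (diffquo g z y - diffquo g z p) + diffquo g z p by ring.
by apply: (le_trans (ler_nrmD _ _)); rewrite lerD2r.
Qed.

(* Bisecting repeatedly, only the corner triangle at [z] is not covered by
   Goursat's lemma, and its contribution is bounded by its perimeter. *)
Lemma triint_corner L g z w (B : R) : compact L -> midclosed L -> L z ->
  (forall p, L p -> cdiff g p) ->
  (forall x, L x -> nrm (diffquo g z x) <= B) ->
  forall k (r : R) b c, 0 < r -> L b -> L c ->
  r + re (w * z) <= re (w * b) -> r + re (w * z) <= re (w * c) ->
  forall e : R, 0 < e -> exists M, forall m, (M <= m)%N ->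
    nrm (triint m z b c (diffquo g z)) <= e + B * perim z b c / 2 ^+ k.
Proof.
move=> Lc Lm Lz gd gB; elim=> [|k IH] r b c r0 Lb Lc' rb rc' e e0.
  exists 0%N => m _; rewrite expr0 divr1 mulrC.
  apply: (le_trans (ler_triint _ Lm gB Lz Lb Lc')).
  by rewrite lerDr ltW.
have r20 : 0 < r / 2 by rewrite divr_gt0.
have e40 : 0 < e / 4 by rewrite divr_gt0.
(* A half plane off [z] that contains the three triangles without a corner at [z]. The margin
   [r / 2] is what the midpoints of the edges from [z] retain, and it is the margin for the
   induction. *)
pose H := [set x | r / 2 + re (w * z) <= re (w * x)].
have LHm : midclosed (L `&` H) by apply: midclosedI => //; exact: midclosed_half.
have reh x y : re (w * ((x + y) / 2)) = (re (w * x) + re (w * y)) / 2.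
  have -> : w * ((x + y) / 2) = rc (2^-1) * (w * x + w * y).
    by rewrite rcV rc_nat; field.
  by rewrite reM re_rc im_rc reD; field.
have Hb : (L `&` H) b by split=> //; rewrite /H /=; lra.
have Hc : (L `&` H) c by split=> //; rewrite /H /=; lra.
have Hzb : (L `&` H) ((z + b) / 2).
  by split; [exact: Lm | rewrite /H /= reh; lra].
have Hcz : (L `&` H) ((c + z) / 2).
  by split; [exact: Lm | rewrite /H /= reh; lra].
have Hbc := LHm _ _ Hb Hc.
have LHc : compact (L `&` H).
  apply: compact_closedI => //.
  rewrite -[H]setCK; apply: open_closedC; rewrite openE => x xnH.
  have xH : re (w * x) < r / 2 + re (w * z).
    by rewrite ltNge; apply/negP => xH; exact: xnH.
  apply/interior_nrmP.
  exists ((r / 2 + re (w * z) - re (w * x)) / (nrm w + 1)).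
    apply: divr_gt0; first by rewrite subr_gt0.
    by rewrite ltr_wpDl ?nrm_ge0.
  have nw1 : 0 < nrm w + 1 by rewrite ltr_wpDl ?nrm_ge0.
  move=> y; rewrite ltr_pdivlMr // => yx.
  rewrite /H /setC /=; apply/negP; rewrite -ltNge.
  have := re_le (w * (y - x)); rewrite nrmM mulrBr reD reN => H1.
  have := nrm_ge0 (y - x); move: yx H1; nra.
have LHd p : (L `&` H) p -> cdiff (diffquo g z) p.
  move=> [Lp Hp]; apply: cdiff_diffquo (gd p Lp).
  by apply/eqP => pz; move: Hp; rewrite pz /H /=; lra.
have [M1 P1] := IH _ _ _ r20 Hzb.1 Hcz.1 Hzb.2 Hcz.2 _ e40.
have [M2 P2] := goursat LHc LHm LHd Hb Hbc Hzb e40.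
have [M3 P3] := goursat LHc LHm LHd Hc Hcz Hbc e40.
have [M4 P4] := goursat LHc LHm LHd Hzb Hbc Hcz e40.
exists (maxn (maxn M1 M2) (maxn M3 M4)).+1 => -[//|m].
rewrite ltnS !geq_max => /andP[/andP[m1 m2] /andP[m3 m4]].
rewrite triint_split.
have := P1 m m1; have := P2 m m2; have := P3 m m3; have := P4 m m4.
rewrite (perim_half1 z b c) => q4 q3 q2 q1.
apply: (le_trans (ler_nrmD _ _)).
apply: (le_trans (lerD (le_trans (ler_nrmD _ _)
  (lerD (ler_nrmD _ _) (lexx _))) (lexx _))).
apply: (le_trans (lerD (lerD (lerD q1 q2) q3) q4)).
by rewrite le_eqVlt; apply/orP; left; apply/eqP; rewrite exprS; field.
Qed.

End Goursat.

(** * Cauchy's formula on a closed polygon *)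

Definition edgeint {R : realType} (m : nat) (S : seq (Cplx R * Cplx R))
    (phi : Cplx R -> Cplx R) : Cplx R :=
  \sum_(e <- S) segint m e.1 e.2 phi.

(** A cycle, expressed by its effect: the increments of any function telescope to zero. It is used
    for the trapezoid sum from a fixed apex and for the primitive of [(x - z) ^- 2]. *)
Definition closed_chain {R : realType} (S : seq (Cplx R * Cplx R)) :=
  forall A : Cplx R -> Cplx R, \sum_(e <- S) (A e.2 - A e.1) = 0.

(** A midpoint-closed set around each edge stands for its nodes, so that the condition serves every
    level [m]. *)
Definition on_edges {R : realType} (S : seq (Cplx R * Cplx R))
    (Q : Cplx R * Cplx R -> Cplx R -> Prop) :=
  forall e, e \in S -> exists P : set (Cplx R),
    [/\ midclosed P, P e.1, P e.2 & forall x, P x -> Q e x].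

Definition chain_len {R : realType} (S : seq (Cplx R * Cplx R)) : R :=
  \sum_(e <- S) nrm (e.2 - e.1).

Section EdgeIntegral.
Context {R : realType}.
Implicit Types (a b c z p : Cplx R) (g phi psi : Cplx R -> Cplx R).
Implicit Types (L K : set (Cplx R)) (S : seq (Cplx R * Cplx R)).

Lemma on_edges_sub S (Q Q' : Cplx R * Cplx R -> Cplx R -> Prop) :
  (forall e x, e \in S -> Q e x -> Q' e x) -> on_edges S Q -> on_edges S Q'.
Proof.
move=> QQ' SQ e eS; have [P [Pm P1 P2 PQ]] := SQ e eS.
by exists P; split=> // x /PQ; exact: QQ'.
Qed.

Lemma chain_len_ge0 S : 0 <= chain_len S.
Proof. by apply: sumr_ge0 => e _; exact: nrm_ge0. Qed.

Lemma edgeint_ext S phi psi m :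
  on_edges S (fun _ x => phi x = psi x) -> edgeint m S phi = edgeint m S psi.
Proof.
move=> H; apply: eq_big_seq => e /H[P [Pm P1 P2 PQ]].
exact: (segint_ext _ Pm PQ).
Qed.

Lemma edgeintD S phi psi m :
  edgeint m S (fun x => phi x + psi x) = edgeint m S phi + edgeint m S psi.
Proof. by rewrite -big_split; apply: eq_bigr => e _; rewrite segintD. Qed.

Lemma edgeintB S phi psi m :
  edgeint m S (fun x => phi x - psi x) = edgeint m S phi - edgeint m S psi.
Proof. by rewrite -sumrB; apply: eq_bigr => e _; rewrite segintB. Qed.

Lemma edgeintZ S k phi m :
  edgeint m S (fun x => k * phi x) = k * edgeint m S phi.
Proof. by rewrite /edgeint mulr_sumr; apply: eq_bigr => e _; rewrite segintZ. Qed.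

Lemma ler_edgeint S (B : Cplx R * Cplx R -> R) phi m :
  on_edges S (fun e x => nrm (phi x) <= B e) ->
  nrm (edgeint m S phi) <= \sum_(e <- S) nrm (e.2 - e.1) * B e.
Proof.
move=> H; apply: (le_trans (nrm_sum _ _)).
rewrite big_seq_cond [X in _ <= X]big_seq_cond; apply: ler_sum => e.
rewrite andbT => /H[P [Pm P1 P2 PQ]]; exact: (ler_segint _ Pm PQ).
Qed.

Lemma ler_edgeint_cst S (B : R) phi m :
  on_edges S (fun _ x => nrm (phi x) <= B) ->
  nrm (edgeint m S phi) <= chain_len S * B.
Proof. by move=> /ler_edgeint H; rewrite /chain_len mulr_suml. Qed.

(** In the fan of triangles from [z] over the edges, the spokes cancel. *)
Lemma sum_triint S z phi m : closed_chain S ->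
  \sum_(e <- S) triint m z e.1 e.2 phi = edgeint m S phi.
Proof.
move=> Sc; transitivity (edgeint m S phi -
    \sum_(e <- S) (segint m z e.2 phi - segint m z e.1 phi)); last first.
  by rewrite (Sc (fun x => segint m z x phi)) subr0.
rewrite /edgeint -sumrB; apply: eq_bigr => e _.
by rewrite /triint (segint_rev _ _ z e.2); ring.
Qed.

(** Every triangle of the fan from [z] lies, apart from its corner, on one side of a line through
    [z]; the direction [w] may change from edge to edge. *)
Lemma cauchy_diffquo L g z S : compact L -> midclosed L -> L z ->
  (forall p, L p -> cdiff g p) -> closed_chain S ->
  (forall e, e \in S -> L e.1 /\ L e.2) ->
  (forall e, e \in S -> exists w, exists2 r : R, 0 < r &
    r + re (w * z) <= re (w * e.1) /\ r + re (w * z) <= re (w * e.2)) ->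
  forall e : R, 0 < e -> exists M, forall m, (M <= m)%N ->
    nrm (edgeint m S (diffquo g z)) <= e.
Proof.
move=> Lc Lm Lz gd Sc SL Sw.
have [B B0 BP] := diffquo_bounded Lc Lz gd.
suff H (T : seq (Cplx R * Cplx R)) : {subset T <= S} ->
    forall e : R, 0 < e -> exists M, forall m, (M <= m)%N ->
    nrm (\sum_(e <- T) triint m z e.1 e.2 (diffquo g z)) <= e.
  move=> e e0; have [|M MP] := H S _ e e0; first by [].
  by exists M => m /MP; rewrite sum_triint.
elim: T => [|t T IH] TS e e0.
  by exists 0%N => m _; rewrite big_nil nrm0 ltW.
have tS : t \in S by apply: TS; rewrite mem_head.
have e30 : 0 < e / 3 by rewrite divr_gt0.
have [|M1 P1] := IH _ _ e30; first by move=> x xT; apply: TS; rewrite in_cons xT orbT.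
have [w [r r0 [w1 w2]]] := Sw t tS; have [L1 L2] := SL t tS.
have [k kP] := exists_div_exp2_lt
  (mulr_ge0 (ltW B0) (perim_ge0 z t.1 t.2)) e30.
have [M2 P2] := triint_corner Lc Lm Lz gd BP k r0 L1 L2 w1 w2 e30.
exists (maxn M1 M2) => m; rewrite geq_max => /andP[/P1 m1 /P2 m2].
rewrite big_cons; apply: (le_trans (ler_nrmD _ _)); lra.
Qed.

(** One trapezoid has the exact error [(b - a)^3 / (2 (a - z)^2 (b - z)^2)] against the primitive.
    Bisection divides the cubes by 8 and doubles their number; of the resulting factor [1/4] only
    [1/2] is retained. *)
Lemma segint_inv2 z (r : R) (P : set (Cplx R)) m a b : 0 < r -> midclosed P ->
  (forall x, P x -> r <= nrm (x - z)) -> P a -> P b ->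
  nrm (segint m a b (fun x => (x - z) ^- 2) - ((a - z)^-1 - (b - z)^-1)) <=
  nrm (b - a) ^+ 3 / r ^+ 4 / 2 ^+ m.
Proof.
move=> r0 Pm Pr.
have nz x : P x -> x - z != 0.
  by move=> /Pr H; rewrite -nrm_gt0; exact: lt_le_trans H.
elim: m a b => [|m IH] a b Pa Pb /=.
  have -> : (b - a) * ((a - z) ^- 2 + (b - z) ^- 2) / 2 -
      ((a - z)^-1 - (b - z)^-1) =
      (b - a) ^+ 3 / ((a - z) ^+ 2 * (b - z) ^+ 2) / 2.
    by field; rewrite !nz.
  rewrite expr0 divr1 nrm_half nrmM nrmV (nrmM (_ ^+ 2)) !nrmX.
  set A := nrm (b - a) ^+ 3.
  have A0 : 0 <= A by rewrite exprn_ge0 ?nrm_ge0.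
  have H : r ^+ 4 <= nrm (a - z) ^+ 2 * nrm (b - z) ^+ 2.
    have r2 x : P x -> r ^+ 2 <= nrm (x - z) ^+ 2.
      by move=> /Pr H; rewrite lerXn2r // nnegrE ?nrm_ge0 // ltW.
    by rewrite (_ : 4 = 2 + 2)%N // exprD ler_pM ?sqr_ge0 ?r2.
  have r40 : 0 < r ^+ 4 by rewrite exprn_gt0.
  have H2 : A / (nrm (a - z) ^+ 2 * nrm (b - z) ^+ 2) <= A / r ^+ 4.
    by rewrite ler_wpM2l // lef_pV2 // posrE; exact: lt_le_trans H.
  apply: le_trans H2; rewrite ler_pdivrMr // ler_peMr ?ler1n //.
  by rewrite mulr_ge0 // invr_ge0 mulr_ge0 ?exprn_ge0 ?nrm_ge0.
have Pc := Pm _ _ Pa Pb.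
have := IH _ _ Pa Pc; have := IH _ _ Pc Pb.
have -> : (a + b) / 2 - a = (b - a) / 2 by field.
have -> : b - (a + b) / 2 = (b - a) / 2 by field.
rewrite nrm_half; set c := (a + b) / 2; set B := _ / _ / _ => H1 H2.
have -> : segint m a c (fun x => (x - z) ^- 2) +
    segint m c b (fun x => (x - z) ^- 2) - ((a - z)^-1 - (b - z)^-1) =
  (segint m a c (fun x => (x - z) ^- 2) - ((a - z)^-1 - (c - z)^-1)) +
  (segint m c b (fun x => (x - z) ^- 2) - ((c - z)^-1 - (b - z)^-1)) by ring.
apply: (le_trans (ler_nrmD _ _)); apply: (le_trans (lerD H2 H1)).
have -> : B + B = nrm (b - a) ^+ 3 / r ^+ 4 / 2 ^+ m.+1 / 2.
  rewrite /B [2 ^+ m.+1]exprS; field.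
  by rewrite expf_neq0 // gt_eqF.
rewrite ler_pdivrMr // ler_peMr ?ler1n //.
by rewrite !divr_ge0 ?exprn_ge0 ?nrm_ge0 // ltW.
Qed.

(** Passing through the midpoint keeps the linear term and halves the quadratic one, which
    disappears after repeated bisection. *)
Lemma lipschitz_of_quadratic K (F : Cplx R -> Cplx R) (h C : R) :
  midclosed K -> 0 <= C ->
  (forall x y, K x -> K y ->
    nrm (F x - F y) <= nrm (x - y) * (h + C * nrm (x - y))) ->
  forall x y, K x -> K y -> nrm (F x - F y) <= nrm (x - y) * h.
Proof.
move=> Km C0 FK.
have H k : forall x y, K x -> K y ->
    nrm (F x - F y) <= nrm (x - y) * (h + C * nrm (x - y) / 2 ^+ k).
  elim: k => [|k IH] x y Kx Ky; first by rewrite expr0 divr1 FK.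
  have Kc := Km _ _ Kx Ky.
  apply: (le_trans (nrm_tri _ (F ((x + y) / 2)) _)).
  apply: (le_trans (lerD (IH _ _ Kx Kc) (IH _ _ Kc Ky))).
  have -> : x - (x + y) / 2 = (x - y) / 2 by field.
  have -> : (x + y) / 2 - y = (x - y) / 2 by field.
  rewrite nrm_half le_eqVlt; apply/orP; left; apply/eqP.
  by rewrite exprS; field.
move=> x y Kx Ky; apply/ler_addgt0Pr => e e0.
have d0 := nrm_ge0 (x - y).
have [||k kP] := @exists_div_exp2_lt R (C * nrm (x - y) * nrm (x - y)) e.
- by rewrite !mulr_ge0.
- by [].
apply: (le_trans (H k x y Kx Ky)); rewrite mulrDr lerD2l.
by rewrite mulrC mulrAC ltW.
Qed.

(** The derivative of the winding sum in its pole is the sum of [(x - z) ^- 2], whose exact integral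
    over a cycle is zero; only the trapezoid error is left, and it tends to [0] with growing [m]. *)
Lemma winding_lipschitz K S (r : R) m : midclosed K -> 0 < r -> closed_chain S ->
  on_edges S (fun _ x => forall z, K z -> r <= nrm (x - z)) ->
  forall y z, K y -> K z ->
  nrm (edgeint m S (fun x => (x - y)^-1) - edgeint m S (fun x => (x - z)^-1)) <=
  nrm (y - z) *
    (\sum_(e <- S) nrm (e.2 - e.1) ^+ 3 / r ^+ 4 / 2 ^+ m).
Proof.
move=> Km r0 Sc SK; set h := \sum_(e <- S) _.
apply: (@lipschitz_of_quadratic K
  (fun y => edgeint m S (fun x => (x - y)^-1)) h (chain_len S * r ^- 3)) => //.
  by rewrite mulr_ge0 ?chain_len_ge0 // invr_ge0 exprn_ge0 // ltW.
move=> y z Ky Kz; rewrite -edgeintB.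
(* First-order expansion of [(x - y)^-1] at [z] with exact remainder. *)
rewrite (@edgeint_ext _ _ (fun x => (y - z) * (x - z) ^- 2 +
   (y - z) ^+ 2 * ((x - z) ^- 2 * (x - y)^-1))); last first.
  apply: on_edges_sub SK => e x _ H.
  have nz : x - z != 0 by rewrite -nrm_gt0; exact: lt_le_trans (H z Kz).
  have ny : x - y != 0 by rewrite -nrm_gt0; exact: lt_le_trans (H y Ky).
  by field; rewrite nz ny.
rewrite edgeintD !edgeintZ.
have -> : nrm (y - z) * (h + chain_len S * r ^- 3 * nrm (y - z)) =
   nrm (y - z) * h + nrm (y - z) ^+ 2 * (chain_len S * r ^- 3) by ring.
apply: (le_trans (ler_nrmD _ _)); rewrite (nrmM (y - z)) (nrmM (_ ^+ 2)) nrmX.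
apply: lerD; last first.
  rewrite ler_wpM2l ?exprn_ge0 ?nrm_ge0 //.
  apply: ler_edgeint_cst; apply: on_edges_sub SK => e x _ H.
  rewrite nrmM nrmV nrmX nrmV -invfM lef_pV2 ?posrE; last 2 first.
  - by rewrite mulr_gt0 ?exprn_gt0 //; exact: lt_le_trans (H _ _).
  - by rewrite exprn_gt0.
  rewrite exprSr ler_pM ?sqr_ge0 ?H //; first exact: ltW.
  by rewrite lerXn2r ?nnegrE ?nrm_ge0 ?H // ltW.
rewrite ler_wpM2l ?nrm_ge0 //.
rewrite (_ : edgeint m S (fun x => (x - z) ^- 2) =
  edgeint m S (fun x => (x - z) ^- 2) -
  \sum_(e <- S) (- (e.2 - z)^-1 - - (e.1 - z)^-1)); last first.
  by rewrite (Sc (fun x => - (x - z)^-1)) subr0.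
rewrite /edgeint -sumrB.
apply: (le_trans (nrm_sum _ _)).
rewrite /h big_seq_cond [X in _ <= X]big_seq_cond; apply: ler_sum => e.
rewrite andbT => /SK[P [Pm P1 P2 PQ]].
rewrite opprK [- _ + _]addrC.
by apply: (segint_inv2 _ r0 Pm) => // x /PQ; exact.
Qed.

(** [im (b * cj a)] is twice the signed area of the triangle [0, a, b]. One trapezoid gives this
    times the mean of [|a|^-2] and [|b|^-2], and a midpoint splits the area into equal halves, so
    the bound is the same at every level. *)
Lemma im_segint_inv (P : set (Cplx R)) (D : R) m a b : midclosed P ->
  (forall x, P x -> 0 < nrm x <= D) -> P a -> P b -> 0 <= im (b * cj a) ->
  im (b * cj a) / D ^+ 2 <= im (segint m a b (fun x => x^-1)).
Proof.
move=> Pm PD; elim: m a b => [|m IH] a b Pa Pb ab /=.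
  have /andP[a0 aD] := PD a Pa; have /andP[b0 bD] := PD b Pb.
  have an : a != 0 by rewrite -nrm_gt0.
  have bn : b != 0 by rewrite -nrm_gt0.
  have inv x : x != 0 -> x^-1 = cj x * rc (nrm x ^- 2).
    move=> x0; apply: (mulfI x0); rewrite mulfV // mulrA [x * _]mulrC mul_cj.
    by rewrite -rcM mulfV // expf_neq0 // nrm_eq0.
  have -> : (b - a) * (a^-1 + b^-1) / 2 = (b * a^-1 - a * b^-1) * rc (2^-1).
    by rewrite rcV rc_nat; field; rewrite an bn.
  have -> : b * a^-1 - a * b^-1 =
      (b * cj a) * rc (nrm a ^- 2) - (a * cj b) * rc (nrm b ^- 2).
    by rewrite !inv // !mulrA.
  have im_swap : im (a * cj b) = - im (b * cj a).
    by rewrite !imM !re_cj !im_cj; ring.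
  set t := im (b * cj a) in ab im_swap *.
  rewrite imM imD imN !(imM (_ * _) (rc _)) !im_rc !re_rc !mulr0 !add0r.
  rewrite im_swap -/t.
  have sq (u : R) : 0 < u -> u <= D -> D ^- 2 <= u ^- 2.
    move=> u0 uD; have D0 : 0 < D by exact: lt_le_trans uD.
    by rewrite lef_pV2 ?posrE ?exprn_gt0 // lerXn2r // nnegrE ltW.
  have := sq _ a0 aD; have := sq _ b0 bD; nra.
have Pc := Pm _ _ Pa Pb; rewrite imD.
have c1 : im ((a + b) / 2 * cj a) = im (b * cj a) / 2.
  have -> : (a + b) / 2 * cj a = ((cj a * a) + b * cj a) * rc 2^-1.
    by rewrite rcV rc_nat; field.
  by rewrite mul_cj imM im_rc re_rc imD im_rc; field.
have c2 : im (b * cj ((a + b) / 2)) = im (b * cj a) / 2.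
  have -> : cj ((a + b) / 2) = (cj a + cj b) * rc 2^-1.
    have -> : (a + b) / 2 = (a + b) * rc 2^-1 by rewrite rcV rc_nat.
    by rewrite cjM cj_rc; congr (_ * _); apply: cplx_eq;
      rewrite ?reD ?imD ?re_cj ?im_cj ?reD ?imD ?opprD.
  have -> : b * ((cj a + cj b) * rc 2^-1) = (b * cj a + cj b * b) * rc 2^-1.
    by ring.
  by rewrite mul_cj imM im_rc re_rc imD im_rc; field.
have ab2 : 0 <= im (b * cj a) / 2 by rewrite divr_ge0.
have := IH _ _ Pa Pc; rewrite c1 => /(_ ab2).
have := IH _ _ Pc Pb; rewrite c2 => /(_ ab2).
move=> H1 H2; apply: le_trans (lerD H2 H1); rewrite -mulrDl.
by rewrite le_eqVlt; apply/orP; left; apply/eqP; congr (_ * _); field.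
Qed.

(** This lower bound replaces the value [2 pi i] of the integral of [1/x]. *)
Lemma im_edgeint_inv S (D : R) m :
  on_edges S (fun _ x => 0 < nrm x <= D) ->
  (forall e, e \in S -> 0 <= im (e.2 * cj e.1)) ->
  \sum_(e <- S) im (e.2 * cj e.1) / D ^+ 2 <= im (edgeint m S (fun x => x^-1)).
Proof.
move=> SD Sp.
have -> : im (edgeint m S (fun x => x^-1)) =
    \sum_(e <- S) im (segint m e.1 e.2 (fun x => x^-1)).
  rewrite /edgeint; elim: (S) => [|e T IH]; first by rewrite !big_nil im0.
  by rewrite !big_cons imD IH.
rewrite big_seq_cond [X in _ <= X]big_seq_cond; apply: ler_sum => e.
rewrite andbT => eS; have [P [Pm P1 P2 PQ]] := SD e eS.
exact: im_segint_inv Pm PQ P1 P2 (Sp e eS).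
Qed.

End EdgeIntegral.

Section CauchyFormula.
Context {R : realType}.
Implicit Types (a b c z p : Cplx R) (g phi psi : Cplx R -> Cplx R).
Implicit Types (L K : set (Cplx R)) (S : seq (Cplx R * Cplx R)).

Lemma cdiff_bounded L g : compact L -> (forall p, L p -> cdiff g p) ->
  exists2 B : R, 0 < B & forall z, L z -> nrm (g z) <= B.
Proof.
move=> Lc gd; apply: (@locally_bounded_compact _ L g) => // z.
move=> /gd/cdiff_cont/(_ _ ltr01)[r r0 rP].
exists (1 + nrm (g z)); exists r => // y _ /rP H.
have -> : g y = (g y - g z) + g z by ring.
by apply: (le_trans (ler_nrmD _ _)); rewrite lerD2r.
Qed.

Lemma diffquo_lipschitz g (x y z : Cplx R) (B r : R) : 0 < r ->
  nrm (g x) <= B -> nrm (g z) <= B ->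
  r <= nrm (x - y) -> r <= nrm (x - z) ->
  nrm (diffquo g y x - diffquo g z x) <=
  nrm (g y - g z) / r + 2 * B * nrm (y - z) / r ^+ 2.
Proof.
move=> r0 gx gz ry rz.
have py : 0 < nrm (x - y) by exact: lt_le_trans ry.
have pz : 0 < nrm (x - z) by exact: lt_le_trans rz.
have ny : x - y != 0 by rewrite -nrm_gt0.
have nz : x - z != 0 by rewrite -nrm_gt0.
have -> : diffquo g y x - diffquo g z x = - ((g y - g z) * (x - y)^-1) +
    (g x - g z) * (y - z) * ((x - y)^-1 * (x - z)^-1).
  by rewrite /diffquo; field; rewrite ny nz.
have iy : (nrm (x - y))^-1 <= r^-1 by rewrite lef_pV2.
have iz : (nrm (x - z))^-1 <= r^-1 by rewrite lef_pV2.
apply: (le_trans (ler_nrmD _ _)); rewrite nrmN; apply: lerD.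
  by rewrite nrmM nrmV ler_wpM2l ?nrm_ge0.
rewrite nrmM (nrmM (g x - g z)) nrmM !nrmV.
have iy0 : 0 <= (nrm (x - y))^-1 by rewrite invr_ge0 ltW.
have iz0 : 0 <= (nrm (x - z))^-1 by rewrite invr_ge0 ltW.
apply: ler_pM; rewrite ?mulr_ge0 ?nrm_ge0 //.
  rewrite ler_wpM2r ?nrm_ge0 //.
  by have := ler_nrmB (g x) (g z); lra.
by rewrite expr2 invfM ler_pM.
Qed.

(** Write [g x / (x - z)] as the difference quotient plus [g z / (x - z)]. The sum of the first is
    small for each [z], hence uniformly by compactness, because it depends continuously on [z] with
    a modulus independent of [m]. The sum of the second is moved to the pole [0] by
    [winding_lipschitz], so that one normalising sum serves all [z]. *)
Lemma cauchy_uniform L K S g (r D : R) : compact L -> midclosed L ->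
  compact K -> midclosed K -> K `<=` L -> K 0 -> (forall z, K z -> nrm z <= D) ->
  (forall p, L p -> cdiff g p) -> closed_chain S -> 0 < r ->
  on_edges S (fun _ x => L x /\ forall z, K z -> r <= nrm (x - z)) ->
  (forall e, e \in S -> exists w, exists2 s : R, 0 < s & forall z, K z ->
    s + re (w * z) <= re (w * e.1) /\ s + re (w * z) <= re (w * e.2)) ->
  forall e : R, 0 < e -> exists M, forall m, (M <= m)%N -> forall z, K z ->
    nrm (edgeint m S (fun x => g x / (x - z)) -
         g z * edgeint m S (fun x => x^-1)) <= e.
Proof.
move=> Lc Lm Kc Km KL K0 KD gd Sc r0 SLK Sw e e0.
have [B B0 BP] := cdiff_bounded Lc gd.
have D0 : 0 <= D by have := KD 0 K0; rewrite nrm0.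
have SK : on_edges S (fun _ x => forall z, K z -> r <= nrm (x - z)).
  by apply: on_edges_sub SLK => ? x _ [].
have SL u : u \in S -> L u.1 /\ L u.2.
  by move=> /SLK[P [_ P1 P2 PQ]]; have [] := PQ _ P1; have [] := PQ _ P2.
pose F m z := edgeint m S (diffquo g z).
pose lam := chain_len S + 1; have lam0 : 0 < lam.
  by rewrite ltr_wpDl ?chain_len_ge0.
have e20 : 0 < e / 2 by rewrite divr_gt0.
have e40 : 0 < e / 4 by rewrite divr_gt0.
have [||M1 P1] := @compact_nat_uniform _ K
   (fun n z => forall m, (n <= m)%N -> nrm (F m z) <= e / 2) Kc.
- by move=> i j z ij H m jm; apply: H; exact: leq_trans jm.
- move=> z Kz; have Lz := KL z Kz.
  have Swz u : u \in S -> exists w, exists2 r : R, 0 < r &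
      r + re (w * z) <= re (w * u.1) /\ r + re (w * z) <= re (w * u.2).
    by move=> /Sw[w [s s0 sP]]; exists w; exists s => //; exact: sP.
  have [M MP] := cauchy_diffquo Lc Lm Lz gd Sc SL Swz e40.
  (* Both terms of [diffquo_lipschitz] will be at most [t], and [lam * (2 * t) = e / 4]. *)
  pose t := e / (8 * lam); have t0 : 0 < t by rewrite divr_gt0 ?mulr_gt0.
  have [d d0 dP] := cdiff_cont (gd z Lz) (mulr_gt0 t0 r0).
  have q0 : 0 < t * r ^+ 2 / (2 * B).
    by apply: divr_gt0; apply: mulr_gt0; rewrite ?exprn_gt0.
  exists M; exists (Num.min d (t * r ^+ 2 / (2 * B))).
    by rewrite lt_min d0.
  move=> y Ky; rewrite lt_min => /andP[/dP yd yq] m /MP Fz.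
  have -> : F m y = (F m y - F m z) + F m z by ring.
  apply: (le_trans (ler_nrmD _ _)).
  suff : nrm (F m y - F m z) <= e / 4 by move: Fz; rewrite -/(F m z); lra.
  rewrite /F -edgeintB.
  have : nrm (edgeint m S (fun x => diffquo g y x - diffquo g z x)) <=
      chain_len S * (2 * t).
    apply: ler_edgeint_cst; apply: on_edges_sub SLK => u x _ [Lx xr].
    apply: (le_trans (diffquo_lipschitz r0 (BP x Lx) (BP z Lz)
      (xr y Ky) (xr z Kz))).
    have H1 : nrm (g y - g z) / r <= t by rewrite ler_pdivrMr.
    have H2 : 2 * B * nrm (y - z) / r ^+ 2 <= t.
      rewrite ler_pdivrMr ?exprn_gt0 // mulrC -ler_pdivlMr ?mulr_gt0 //.
      exact: ltW.
    lra.
  move=> /le_trans; apply.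
  have -> : e / 4 = lam * (2 * t) by rewrite /t; field; apply: lt0r_neq0.
  by apply: ler_wpM2r; [rewrite mulr_ge0 // ltW | rewrite /lam lerDl].
pose h := \sum_(u <- S) nrm (u.2 - u.1) ^+ 3 / r ^+ 4.
have h0 : 0 <= h.
  by apply: sumr_ge0 => u _; rewrite divr_ge0 ?exprn_ge0 ?nrm_ge0 ?(ltW r0).
have BDh : 0 <= B * D * h by rewrite !mulr_ge0 // ltW.
have [M2 P2] := exists_div_exp2_lt BDh e20.
exists (maxn M1 M2) => m; rewrite geq_max => /andP[m1 m2] z Kz.
have := P1 z Kz m m1; rewrite /F => Fz.
have -> : edgeint m S (fun x => g x / (x - z)) - g z * edgeint m S (fun x => x^-1)
  = edgeint m S (diffquo g z) + g z * (edgeint m S (fun x => (x - z)^-1) -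
       edgeint m S (fun x => (x - 0)^-1)).
  have -> : edgeint m S (fun x => (x - 0)^-1) = edgeint m S (fun x => x^-1).
    by congr edgeint; apply/funext => x; rewrite subr0.
  rewrite mulrBr -!edgeintZ addrA -edgeintD; congr (_ - _).
  by congr edgeint; apply/funext => x; rewrite /diffquo; ring.
apply: (le_trans (ler_nrmD _ _)).
have W := winding_lipschitz m Km r0 Sc SK Kz K0.
rewrite subr0 in W.
have gz := BP z (KL z Kz).
have hm : \sum_(u <- S) nrm (u.2 - u.1) ^+ 3 / r ^+ 4 / 2 ^+ m <= h / 2 ^+ M2.
  rewrite -mulr_suml ler_wpM2l // lef_pV2 ?posrE ?exprn_gt0 //.
  by rewrite ler_weXn2l // ler1n.
suff : nrm (g z * (edgeint m S (fun x => (x - z)^-1) -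
       edgeint m S (fun x => (x - 0)^-1))) <= e / 2 by lra.
rewrite nrmM.
have h20 : 0 <= h / 2 ^+ M2 by rewrite divr_ge0 ?exprn_ge0.
apply: (@le_trans _ _ (B * (D * (h / 2 ^+ M2)))).
  apply: ler_pM => //; rewrite ?nrm_ge0 //.
  apply: (le_trans W); apply: ler_pM; rewrite ?nrm_ge0 ?KD //.
  by apply: sumr_ge0 => u _; rewrite !divr_ge0 ?exprn_ge0 ?nrm_ge0 ?(ltW r0).
by apply: ltW; move: P2; rewrite !mulrA.
Qed.

End CauchyFormula.

(** * The peak kernel *)

(* Fejer-type averages of the powers [s^k, ..., s^(2k-1)] of the polynomial
   [s = 1 + x + x^2], which peaks at [0] on the half disc
   [re x <= 0, |x| <= 1/4]; [(1 - peak_avg k x) / (- x)] is a polynomial. *)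
Definition peak {A : pzRingType} (x : A) : A := 1 + x + x ^+ 2.

Definition peak_avg {R : realType} (k : nat) (x : Cplx R) : Cplx R :=
  k%:R^-1 * \sum_(i < k) peak x ^+ (k + i).

Definition peak_quo {A : pzRingType} (k : nat) (x : A) : A :=
  \sum_(i < k) (1 + x) * \sum_(j < k + i) peak x ^+ j.

(** For [k > 0], nonzero [al] and [z] different from [zeta] its value is
    [(1 - peak_avg k x) / (zeta - z)] with [x = al * (z - zeta)]. The factor [al] turns and shrinks
    the plane so that [K], seen from [zeta], falls into the half disc where [peak] is at most 1. *)
Definition kernel_poly {R : realType} (k : nat) (al zeta : Cplx R) :
    {poly Cplx R} :=
  (al * k%:R^-1) *: peak_quo k (al *: ('X - zeta%:P)).

Section PeakKernel.
Context {R : realType}.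
Implicit Types (x z zeta al w : Cplx R).

Lemma size_kernel_poly k al zeta : (size (kernel_poly k al zeta) <= 4 * k)%N.
Proof.
set X := al *: ('X - zeta%:P).
have sX : (size X <= 2)%N.
  by apply: (leq_trans (size_scale_leq _ _)); rewrite size_XsubC.
have s1X : (size (1 + X)%R <= 2)%N.
  by apply: (leq_trans (size_polyD _ _)); rewrite size_poly1 geq_max sX.
have sp : (size (peak X) <= 3)%N.
  apply: (leq_trans (size_polyD _ _)); rewrite geq_max (leq_trans s1X) //=.
  apply: (leq_trans (size_poly_exp_leq _ _)).
  have X1 : ((size X).-1 <= 1)%N by rewrite -subn1 leq_subLR.
  by rewrite ltnS (leq_mul X1 (leqnn 2)).
apply: (leq_trans (size_scale_leq _ _)).
apply: (leq_trans (size_sum _ _ _)); apply/bigmax_leqP => i _.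
have k0 : (0 < k)%N by exact: leq_ltn_trans (ltn_ord i).
apply: (leq_trans (size_polyMleq _ _)).
have : (size (\sum_(j < k + i) peak X ^+ j)%R <= 4 * k - 2)%N.
  apply: (leq_trans (size_sum _ _ _)); apply/bigmax_leqP => j _.
  apply: (leq_trans (size_poly_exp_leq _ _)).
  have : ((size (peak X)).-1 * j <= 2 * j)%N.
    by rewrite leq_mul2r -subn1 leq_subLR sp orbT.
  by have := ltn_ord j; have := ltn_ord i; lia.
move: (size _) (size _) s1X => u v; lia.
Qed.

Lemma horner_peak (X : {poly Cplx R}) z : (peak X).[z] = peak X.[z].
Proof. by rewrite /peak !hornerE. Qed.

Lemma horner_kernel k al zeta z : (kernel_poly k al zeta).[z] =
  al * (k%:R^-1 * peak_quo k (al * (z - zeta))).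
Proof.
rewrite hornerZ -mulrA; congr (_ * (_ * _)).
rewrite horner_sum; apply: eq_bigr => i _; rewrite hornerM !hornerE; congr (_ * _).
rewrite horner_sum; apply: eq_bigr => j _.
by rewrite horner_exp horner_peak !hornerE.
Qed.

Lemma peak_quoE k x : (0 < k)%N ->
  - x * (k%:R^-1 * peak_quo k x) = 1 - peak_avg k x.
Proof.
move=> k0; have kn : (k%:R : Cplx R) != 0 by rewrite pnatr_eq0 -lt0n.
apply: (mulfI kn); rewrite mulrBr mulr1 /peak_avg mulrCA !mulVKf //.
rewrite mulr_sumr.
have -> : (k%:R : Cplx R) = \sum_(i < k) 1 by rewrite sumr_const card_ord.
rewrite -sumrB; apply: eq_bigr => i _.
rewrite -[X in X - _](expr1n _ (k + i)) subrXX.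
rewrite /peak mulrA; congr (_ * _); first by ring.
by apply: eq_bigr => j _; rewrite expr1n mul1r.
Qed.

(** The geometric sum turns [k] powers into two, so the average carries a factor [1 / (k * x)]: this
    is the gain over a single power. *)
Lemma peak_avgE k x : (0 < k)%N ->
  k%:R * peak_avg k x * (- x * (1 + x)) = peak x ^+ k * (1 - peak x ^+ k).
Proof.
move=> k0; have kn : (k%:R : Cplx R) != 0 by rewrite pnatr_eq0 -lt0n.
rewrite /peak_avg mulVKf //.
have -> : \sum_(i < k) peak x ^+ (k + i) =
    peak x ^+ k * \sum_(i < k) peak x ^+ i.
  by rewrite mulr_sumr; apply: eq_bigr => i _; rewrite exprD.
rewrite -mulrA; congr (_ * _).
rewrite -[X in X - _](expr1n _ k) subrXX mulrC; congr (_ * _).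
  by rewrite /peak; ring.
by apply: eq_bigr => j _; rewrite expr1n mul1r.
Qed.

(** With [x = p + i q], the square [|1 + x|^2] contains [+ q^2] and exceeds 1 near the imaginary
    axis. The term [x^2] turns this into [- q^2], which absorbs the terms of fourth order. *)
Lemma nrm_peak_sqr x : re x <= 0 -> nrm x <= 1 / 4 ->
  nrm (peak x) ^+ 2 <= 1 + re x.
Proof.
move=> x0 x1.
have sq : re x ^+ 2 + im x ^+ 2 <= 1 / 16.
  by rewrite -nrm_sqr; have := nrm_ge0 x; nra.
rewrite nrm_sqr /peak expr2 !reD !imD reM imM re1 im1.
have p1 : - (1 / 4) <= re x.
  by have := abs_re_le x; rewrite ler_norml => /andP[]; lra.
move: (re x) (im x) x0 sq p1 => p q p0 sq p1.
have -> : (1 + p + (p * p - q * q)) ^+ 2 + (0 + q + (p * q + q * p)) ^+ 2 =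
  1 + 2 * p + 3 * p ^+ 2 - q ^+ 2 + 2 * p * (p ^+ 2 + q ^+ 2) +
  (p ^+ 2 + q ^+ 2) ^+ 2 by ring.
have p20 := sqr_ge0 p; have q20 := sqr_ge0 q.
have h1 : (p ^+ 2 + q ^+ 2) ^+ 2 <= (p ^+ 2 + q ^+ 2) / 16 by nra.
have h2 : 2 * p * (p ^+ 2 + q ^+ 2) <= 0.
  by rewrite mulr_le0_ge0 ?addr_ge0 // pmulr_rle0.
have h3 : p ^+ 2 <= - p / 4 by nra.
lra.
Qed.

Lemma nrm_peak_le (d : R) x : 0 <= d <= 1 -> re x <= - d -> nrm x <= 1 / 4 ->
  nrm (peak x) <= 1 - d / 2.
Proof.
move=> /andP[d0 d1] xd x1.
rewrite -(@ler_pXn2r _ 2) ?nnegrE ?nrm_ge0 //; last by lra.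
by apply: (le_trans (nrm_peak_sqr _ x1)); [lra|nra].
Qed.

Lemma nrm_peak_le1 x : re x <= 0 -> nrm x <= 1 / 4 -> nrm (peak x) <= 1.
Proof.
move=> x0 x1; have := @nrm_peak_le 0 x; rewrite mul0r subr0 oppr0; apply=> //.
by rewrite lexx ler01.
Qed.

Lemma nrm_peak_avg k x : (0 < k)%N -> nrm (peak x) <= 1 ->
  nrm (peak_avg k x) <= nrm (peak x) ^+ k.
Proof.
move=> k0 p1; rewrite /peak_avg nrmM nrmV nrm_nat.
rewrite ler_pdivrMl ?ltr0n //; apply: (le_trans (nrm_sum _ _)).
apply: (@le_trans _ _ (\sum_(i < k) nrm (peak x) ^+ k)).
  apply: ler_sum => i _; rewrite nrmX exprD.
  by rewrite ler_piMr ?exprn_ge0 ?nrm_ge0 // exprn_ile1 ?nrm_ge0.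
by rewrite sumr_const card_ord mulr_natl.
Qed.

(** In [peak_avgE] the right side is at most 2 and [|1 + x| >= 3 / 4]. *)
Lemma nrm_peak_avg_far k x : (0 < k)%N -> re x <= 0 -> nrm x <= 1 / 4 ->
  nrm (peak_avg k x) * (k%:R * nrm x) <= 3.
Proof.
move=> k0 x0 x1; have p1 := nrm_peak_le1 x0 x1.
have := congr1 nrm (peak_avgE x k0).
rewrite (nrmM (k%:R * _)) (nrmM k%:R) (nrmM (- x)) (nrmM (_ ^+ k)) nrm_nat nrmN.
have x34 : 3 / 4 <= nrm (1 + x).
  have := ler_nrmB (1 + x) x; have -> : 1 + x - x = 1 by ring.
  by rewrite nrm1; lra.
have pk : nrm (peak x ^+ k) <= 1 by rewrite nrmX exprn_ile1 ?nrm_ge0.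
have := ler_nrmB 1 (peak x ^+ k); rewrite nrm1 => pk2 e.
have e2 : k%:R * nrm (peak_avg k x) * (nrm x * nrm (1 + x)) <= 2.
  rewrite e; have := nrm_ge0 (peak x ^+ k); have := nrm_ge0 (1 - peak x ^+ k).
  nra.
have A0 : 0 <= k%:R * nrm (peak_avg k x) * nrm x.
  by rewrite !mulr_ge0 ?nrm_ge0.
nra.
Qed.

Lemma nrm_peak_quo k x : (0 < k)%N -> nrm (peak x) <= 1 -> nrm x <= 1 / 4 ->
  nrm (k%:R^-1 * peak_quo k x) <= 3 * k%:R.
Proof.
move=> k0 p1 x1; rewrite nrmM nrmV nrm_nat ler_pdivrMl ?ltr0n //.
apply: (le_trans (nrm_sum _ _)).
apply: (@le_trans _ _ (\sum_(i < k) 3 * k%:R)); last first.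
  by rewrite sumr_const card_ord -[X in X <= _]mulr_natl.
apply: ler_sum => i _; rewrite nrmM.
have h1 : nrm (1 + x) <= 5 / 4.
  by apply: (le_trans (ler_nrmD _ _)); rewrite nrm1; lra.
have h2 : nrm (\sum_(j < k + i) peak x ^+ j) <= 2 * k%:R.
  apply: (le_trans (nrm_sum _ _)).
  apply: (@le_trans _ _ (\sum_(j < k + i) 1)).
    by apply: ler_sum => j _; rewrite nrmX exprn_ile1 ?nrm_ge0.
  rewrite sumr_const card_ord -natrM ler_nat.
  by have := ltn_ord i; lia.
have := nrm_ge0 (1 + x); have := nrm_ge0 (\sum_(j < k + i) peak x ^+ j).
have : 0 <= k%:R :> R by []; nra.
Qed.

Lemma kernel_diff k al zeta z : (0 < k)%N -> al != 0 -> zeta != z ->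
  (kernel_poly k al zeta).[z] - (zeta - z)^-1 =
  - peak_avg k (al * (z - zeta)) / (zeta - z).
Proof.
move=> k0 al0 zz; have n0 : zeta - z != 0 by rewrite subr_eq0.
rewrite horner_kernel; have := peak_quoE (al * (z - zeta)) k0.
set y := k%:R^-1 * _; set u := peak_avg _ _ => e.
have -> : u = 1 - (- (al * (z - zeta)) * y) by rewrite e; ring.
by field.
Qed.

(* [z0] is the point [z] pulled inside: its distance to the singularity
   [zeta] is at least comparable to [k^-1]. *)
Lemma kernel_compare k al zeta z z0 (a rho D : R) : (0 < k)%N ->
  0 < a -> 0 < rho -> 0 < D -> nrm al = a ->
  re (al * (z - zeta)) <= 0 -> nrm (al * (z - zeta)) <= 1 / 4 ->
  nrm (z - z0) <= k%:R^-1 * D -> rho * k%:R^-1 <= nrm (zeta - z0) ->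
  nrm ((kernel_poly k al zeta).[z] - (zeta - z0)^-1) <=
  (12 * a + 4 / rho + 4 * (3 / a + D * (1 + D / rho))) *
    (k%:R^-1 / (k%:R^-1 + nrm (zeta - z)) ^+ 2).
Proof.
move=> k0 a0 rho0 D0 ala xr xn zz0 zetaz0.
set q : R := k%:R^-1 in zz0 zetaz0 *.
set t := nrm (zeta - z); set ts := nrm (zeta - z0) in zetaz0 *.
have q0 : 0 < q by rewrite invr_gt0 ltr0n.
have t0 : 0 <= t by exact: nrm_ge0.
have ts0 : 0 < ts by apply: lt_le_trans zetaz0; rewrite mulr_gt0.
have p1 := nrm_peak_le1 xr xn.
have xt : nrm (al * (z - zeta)) = a * t by rewrite nrmM ala nrmBC.
have zn0 : zeta - z0 != 0 by rewrite -nrm_gt0.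
set c1 := 12 * a + 4 / rho; set c2 := 4 * (3 / a + D * (1 + D / rho)).
have c10 : 0 <= c1 by rewrite addr_ge0 ?mulr_ge0 ?invr_ge0 ?(ltW rho0) ?(ltW a0).
have c20 : 0 <= c2.
  by rewrite mulr_ge0 ?addr_ge0 ?mulr_ge0 ?invr_ge0 ?(ltW rho0) ?(ltW a0) ?(ltW D0)
    // addr_ge0 ?mulr_ge0 ?invr_ge0 ?(ltW rho0) ?(ltW D0).
have qt0 : 0 < q + t by rewrite ltr_pwDl.
have w0 : 0 <= q / (q + t) ^+ 2 by rewrite divr_ge0 ?exprn_ge0 ?ltW.
(* Up to distance [q = 1/k] each of the two kernels is of order [k], which gives [c1]. Beyond it,
   both the error of the polynomial kernel and the shift from [z] to [z0] are of order [q / t ^+ 2],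
   which gives [c2]. *)
have [tq|qt] := lerP t q.
  have w1 : 1 / (4 * q) <= q / (q + t) ^+ 2.
    rewrite ler_pdivlMr ?exprn_gt0 // mulrAC ler_pdivrMr ?mulr_gt0 //.
    by rewrite mul1r; nra.
  have H : nrm ((kernel_poly k al zeta).[z] - (zeta - z0)^-1) <= c1 * (1 / (4 * q)).
    apply: (le_trans (ler_nrmB _ _)); rewrite horner_kernel nrmM ala nrmV -/ts.
    have h1 := nrm_peak_quo k0 p1 xn.
    have kq : k%:R = q^-1 :> R by rewrite invrK.
    rewrite kq in h1.
    have h2 : ts^-1 <= rho^-1 * q^-1.
      by rewrite -invfM lef_pV2 ?posrE ?mulr_gt0.
    have -> : c1 * (1 / (4 * q)) = a * (3 * q^-1) + rho^-1 * q^-1.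
      by rewrite /c1; field; rewrite !gt_eqF.
    apply: lerD => //; rewrite ler_wpM2l ?(ltW a0) //.
  apply: (le_trans H); rewrite (mulrDl c1 c2) -[X in X <= _]addr0; apply: lerD.
    by rewrite ler_wpM2l.
  by rewrite mulr_ge0.
have tp : 0 < t by exact: lt_trans qt.
have zn : zeta != z by rewrite -subr_eq0 -nrm_gt0.
have zn1 : zeta - z != 0 by rewrite subr_eq0.
have al0 : al != 0 by rewrite -nrm_gt0 ala.
have w1 : q / (4 * t ^+ 2) <= q / (q + t) ^+ 2.
  rewrite ler_wpM2l ?(ltW q0) // lef_pV2 ?posrE ?mulr_gt0 ?exprn_gt0 //.
  nra.
have H : nrm ((kernel_poly k al zeta).[z] - (zeta - z0)^-1) <=
    c2 * (q / (4 * t ^+ 2)).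
  have -> : (kernel_poly k al zeta).[z] - (zeta - z0)^-1 =
      ((kernel_poly k al zeta).[z] - (zeta - z)^-1) +
      (z - z0) * ((zeta - z)^-1 * (zeta - z0)^-1).
    by field; rewrite zn0 zn1.
  rewrite kernel_diff //; apply: (le_trans (ler_nrmD _ _)).
  rewrite (nrmM (- _)) nrmN (nrmM (z - z0)) (nrmM (_^-1) (_^-1)) !nrmV -/t -/ts.
  have h1 : nrm (peak_avg k (al * (z - zeta))) <= 3 * q / (a * t).
    have := nrm_peak_avg_far k0 xr xn; rewrite xt => h.
    rewrite ler_pdivlMr ?mulr_gt0 // /q -ler_pdivrMr ?invr_gt0 ?ltr0n //.
    by rewrite invrK -mulrA [a * t * _]mulrC.
  have h2 : ts^-1 <= (1 + D / rho) / t.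
    rewrite -[ts^-1]mul1r ler_pdivrMr // mulrAC ler_pdivlMr // mul1r.
    have : t <= ts + q * D.
      by have := nrm_tri zeta z0 z; rewrite (nrmBC z0 z) -/t -/ts; lra.
    have : q * D <= D / rho * ts.
      by rewrite mulrAC ler_pdivlMr //; nra.
    by rewrite mulrDl mul1r; lra.
  have -> : c2 * (q / (4 * t ^+ 2)) =
      3 * q / (a * t) / t + q * D * (t^-1 * ((1 + D / rho) / t)).
    by rewrite /c2; field; rewrite !gt_eqF.
  have it0 : 0 <= t^-1 by rewrite invr_ge0.
  apply: lerD; first by rewrite ler_wpM2r.
  apply: ler_pM; rewrite ?nrm_ge0 ?mulr_ge0 ?invr_ge0 ?(ltW ts0) //.
  by rewrite ler_wpM2l.
apply: (le_trans H); rewrite (mulrDl c1 c2) -[X in X <= _]add0r; apply: lerD.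
  by rewrite mulr_ge0.
by rewrite ler_wpM2l.
Qed.

(** A margin [s] from the supporting line brings [peak] down to [1 - s / 2] and keeps [|zeta - z|]
    above [s / |al|]. *)
Lemma kernel_exp_close k al zeta z (s : R) : (0 < k)%N -> al != 0 ->
  0 < s -> s <= 1 ->
  re (al * (z - zeta)) <= - s -> nrm (al * (z - zeta)) <= 1 / 4 ->
  nrm ((kernel_poly k al zeta).[z] - (zeta - z)^-1) <=
  nrm al / s * (1 - s / 2) ^+ k.
Proof.
move=> k0 al0 s0 s1 xs xn; have nal : 0 < nrm al by rewrite nrm_gt0.
have xr : re (al * (z - zeta)) <= 0 by lra.
have sx : s <= nrm al * nrm (zeta - z).
  rewrite nrmBC -nrmM; have := abs_re_le (al * (z - zeta)).
  by rewrite ler_norml => /andP[]; lra.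
have zn : zeta != z.
  by apply/eqP => e; move: sx; rewrite e subrr nrm0 mulr0; lra.
have zn0 : 0 < nrm (zeta - z) by rewrite nrm_gt0 subr_eq0.
rewrite kernel_diff // (nrmM (- _)) nrmN nrmV mulrC.
apply: ler_pM; rewrite ?invr_ge0 ?nrm_ge0 //.
  by rewrite ler_pdivlMr // mulrC ler_pdivrMr.
apply: (le_trans (nrm_peak_avg k0 (nrm_peak_le1 xr xn))).
rewrite lerXn2r ?nnegrE ?nrm_ge0 //; first by lra.
by apply: nrm_peak_le => //; rewrite (ltW s0).
Qed.

End PeakKernel.

(** * The contour *)

Definition conv_cplx {R : realType} (K : set (Cplx R)) :=
  forall a b (t : R), K a -> K b -> 0 <= t <= 1 ->
  K (rc t * a + rc (1 - t) * b).

Lemma midclosed_conv {R : realType} (K : set (Cplx R)) :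
  conv_cplx K -> midclosed K.
Proof.
move=> Kv x y Kx Ky; have h : 0 <= (2^-1 : R) <= 1 by apply/andP; split; lra.
have := Kv x y 2^-1 Kx Ky h.
have -> : 1 - 2^-1 = 2^-1 :> R by field.
by have -> : (x + y) / 2 = rc 2^-1 * x + rc 2^-1 * y
  by rewrite rcV rc_nat; field.
Qed.

(** * Supporting lines from the nearest point *)

Section Separation.
Context {R : realType}.
Implicit Types (K : set (Cplx R)) (z zeta w : Cplx R).

Lemma nearest_point K zeta : compact K -> K !=set0 ->
  exists2 p, K p & forall z, K z -> nrm (p - zeta) <= nrm (z - zeta).
Proof.
move=> Kc [k0 Kk0]; pose d := inf [set nrm (z - zeta) | z in K].
have dlb z : K z -> d <= nrm (z - zeta).
  move=> Kz; apply: ge_inf; last by exists z.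
  by exists 0 => _ [y _ <-]; exact: nrm_ge0.
apply: contrapT => nex.
have [||n nP] := @compact_nat_uniform _ K
   (fun n y => d + n.+1%:R^-1 <= nrm (y - zeta)) Kc.
- move=> i j z ij; apply: le_trans; rewrite lerD2l lef_pV2 ?posrE ?ltr0n //.
  by rewrite ler_nat ltnS.
- move=> z Kz.
  have dz : d < nrm (z - zeta).
    rewrite lt_neqAle dlb // andbT; apply/eqP => e; apply: nex.
    by exists z => // y Ky; rewrite -e dlb.
  pose e := (nrm (z - zeta) - d) / 2.
  have e0 : 0 < e by rewrite divr_gt0 ?subr_gt0.
  exists (Num.bound e^-1); exists e => // y Ky yz.
  have : (Num.bound e^-1).+1%:R^-1 <= e.
    rewrite -[X in _ <= X]invrK lef_pV2 ?posrE ?invr_gt0 ?ltr0n //.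
    apply/ltW/(lt_le_trans (archi_boundP _)); first by rewrite invr_ge0 ltW.
    by rewrite ler_nat.
  have := nrm_tri z y zeta; have : nrm (z - y) < e by rewrite nrmBC.
  have aux (n v l u m : R) : v < (n - l) / 2 -> n <= v + m ->
    u <= (n - l) / 2 -> l + u <= m by lra.
  exact: aux.
- have : d + n.+1%:R^-1 <= d.
    apply: lb_le_inf; first by exists (nrm (k0 - zeta)); exists k0.
    by move=> _ [y Ky <-]; exact: nP.
  by rewrite gerDl; apply/negP; rewrite -ltNge invr_gt0 ltr0n.
Qed.

(** The direction is that from the nearest point [p] to [zeta], conjugated because [re (w * x)]
    serves as inner product; a point of [K] beyond the line through [p] would give a nearer one. *)
Lemma separation K zeta (r : R) : compact K -> conv_cplx K -> K !=set0 ->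
  0 < r -> (forall z, K z -> r <= nrm (z - zeta)) ->
  exists2 w, nrm w = 1 & forall z, K z -> re (w * (z - zeta)) <= - r.
Proof.
move=> Kc Kv K0 r0 rK; have [p Kp pP] := nearest_point zeta Kc K0.
set d := nrm (p - zeta) in pP.
have d0 : 0 < d by exact: lt_le_trans (rK p Kp).
exists (cj (zeta - p) * rc d^-1).
  by rewrite nrmM nrm_cj nrmBC nrm_rc_ge0 ?invr_ge0 ?(ltW d0) // mulfV ?gt_eqF.
move=> z Kz.
have E : re (cj (zeta - p) * (z - p)) <= 0.
  rewrite leNgt; apply/negP; set c := re _ => c0.
  have zp : 0 < nrm (z - p) ^+ 2.
    rewrite exprn_gt0 // nrm_gt0; apply/eqP => e.
    by move: c0; rewrite /c e mulr0 re0 ltxx.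
  (* At this point of the segment from [p] to [z] the squared distance to [zeta] has dropped by [2 *
     t * c - t ^+ 2 * |z - p| ^+ 2 >= t * c > 0]. *)
  pose t := Num.min 1 (c / nrm (z - p) ^+ 2).
  have t0 : 0 < t by rewrite lt_min ltr01 divr_gt0.
  have t1 : t <= 1 by rewrite ge_min lexx.
  have tc : t * nrm (z - p) ^+ 2 <= c.
    by rewrite -ler_pdivlMr // ge_min lexx orbT.
  have t01 : 0 <= t <= 1 by rewrite (ltW t0).
  have := pP _ (Kv z p t Kz Kp t01).
  have -> : rc t * z + rc (1 - t) * p - zeta = rc t * (z - p) - (zeta - p).
    by rewrite rcB rc1; ring.
  rewrite -(@ler_pXn2r _ 2) ?nnegrE ?nrm_ge0 // /d nrmBC.
  have aux (s a b a' b' : R) : 0 < s -> 0 < a * a' + b * b' ->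
      s * (a' ^+ 2 + b' ^+ 2) <= a * a' + b * b' ->
      a ^+ 2 + b ^+ 2 <= (s * a' - a) ^+ 2 + (s * b' - b) ^+ 2 -> False.
    move=> s0 c1 /(ler_wpM2l (ltW s0)) H.
    have : 0 < s * (a * a' + b * b') by rewrite mulr_gt0.
    by move: H; rewrite !expr2; lra.
  move: tc c0; rewrite /c !nrm_sqr; move: (zeta - p) (z - p) => u v.
  rewrite !reD !imD !reN !imN !reM !imM !re_rc !im_rc re_cj im_cj.
  rewrite !mul0r subr0 addr0 mulNr opprK => tc c1; exact: aux tc.
have -> : cj (zeta - p) * rc d^-1 * (z - zeta) =
    rc d^-1 * (cj (zeta - p) * (z - p) - cj (zeta - p) * (zeta - p)) by ring.
rewrite mul_cj reM re_rc im_rc mul0r subr0 reD reN re_rc nrmBC -/d.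
have rd : r <= d by exact: rK.
rewrite mulrBr expr2 mulrA mulVf ?gt_eqF // mul1r.
have : d^-1 * re (cj (zeta - p) * (z - p)) <= 0.
  by rewrite pmulr_rle0 ?invr_gt0.
lra.
Qed.

(** An edge of length at most [t] loses at most [t] of the margin [4 * t] of its starting point. *)
Lemma separation_edge w a b z (t : R) : nrm w = 1 -> nrm (b - a) <= t ->
  re (w * (z - a)) <= - (4 * t) ->
  3 * t + re (w * z) <= re (w * a) /\ 3 * t + re (w * z) <= re (w * b).
Proof.
move=> w1 ab; rewrite mulrBr reD reN => H.
have t0 : 0 <= t by exact: le_trans (nrm_ge0 _) ab.
have := abs_re_le (w * (b - a)); rewrite nrmM w1 mul1r ler_norml mulrBr reD reN.
by move=> /andP[h1 h2]; split; lra.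
Qed.

End Separation.

(** * Riemann sums of the weight [q / (q + |x|)^2] *)

Section Telescoping.
Context {R : realType}.
Implicit Types (q h x : R).

(** The weight is the derivative of [x / (q + |x|)], and a step [h <= q] changes [q + |x|] by at
    most a factor 2. *)
Lemma poisson_le_diff q h x : 0 < q -> 0 <= h -> h <= q ->
  h * (q / (q + `|x|) ^+ 2) <= 4 * ((x + h) / (q + `|x + h|) - x / (q + `|x|)).
Proof.
move=> q0 h0 hq.
have frac (u v w : R) : 0 < u -> 0 < v -> w * u <= v -> w / v <= u^-1.
  by move=> u0 v0 wuv; rewrite ler_pdivrMr // ler_pdivlMl // mulrC.
have [x0|x0] := lerP 0 x.
  rewrite (ger0_norm x0) ger0_norm ?addr_ge0 //.
  have a0 : 0 < q + x by lra.
  have b0 : 0 < q + (x + h) by lra.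
  have -> : 4 * ((x + h) / (q + (x + h)) - x / (q + x)) =
      h * q * (4 / ((q + x) * (q + (x + h)))) by field; rewrite !gt_eqF.
  rewrite mulrA; apply: ler_wpM2l; first by rewrite mulr_ge0 // ltW.
  rewrite ler_pdivlMr ?mulr_gt0 // mulrC ler_pdivrMr ?exprn_gt0 //; nra.
rewrite (ltr0_norm x0).
have a0 : 0 < q - x by lra.
have [xh|xh] := lerP (x + h) 0.
  rewrite ler0_norm //.
  have b0 : 0 < q - (x + h) by lra.
  have -> : 4 * ((x + h) / (q - (x + h)) - x / (q - x)) =
      h * q * (4 / ((q - x) * (q - (x + h)))) by field; rewrite !gt_eqF.
  rewrite mulrA; apply: ler_wpM2l; first by rewrite mulr_ge0 // ltW.
  rewrite ler_pdivlMr ?mulr_gt0 // mulrC ler_pdivrMr ?exprn_gt0 //; nra.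
rewrite gtr0_norm //.
have b0 : 0 < q + (x + h) by lra.
have e1 : (x + h) / (2 * q) <= (x + h) / (q + (x + h)).
  by rewrite ler_wpM2l ?(ltW xh) // lef_pV2 ?posrE ?mulr_gt0 //; lra.
have e2 : - x / (2 * q) <= - x / (q - x).
  by rewrite ler_wpM2l ?oppr_ge0 ?(ltW x0) // lef_pV2 ?posrE ?mulr_gt0 //; lra.
have e3 : h * (q / (q - x) ^+ 2) <= h / q.
  apply: ler_wpM2l => //; rewrite ler_pdivrMr ?exprn_gt0 //.
  by rewrite ler_pdivlMl //; nra.
have e4 : h / q = 2 * ((x + h) / (2 * q) + - x / (2 * q)).
  by field; rewrite gt_eqF.
have e5 : 0 <= (x + h) / (2 * q) by rewrite divr_ge0 ?mulr_ge0 ?(ltW xh) ?(ltW q0).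
have e6 : 0 <= - x / (2 * q) by rewrite divr_ge0 ?oppr_ge0 ?mulr_ge0 ?(ltW x0) ?(ltW q0).
have -> : x / (q - x) = - (- x / (q - x)) by rewrite mulNr opprK.
lra.
Qed.

Lemma abs_sigmoid_le1 q x : 0 < q -> `|x / (q + `|x|)| <= 1.
Proof.
move=> q0; have x0 := normr_ge0 x.
have p0 : 0 < q + `|x| by lra.
by rewrite normrM normfV (gtr0_norm p0) ler_pdivrMr // mul1r; lra.
Qed.

(** The primitive stays between -1 and 1, so the telescoped sum is bounded independently of [q],
    [h], [x] and [N]. *)
Lemma sum_poisson_le q h x (N : nat) : 0 < q -> 0 <= h -> h <= q ->
  \sum_(0 <= j < N) h * (q / (q + `|x + j%:R * h|) ^+ 2) <= 8.
Proof.
move=> q0 h0 hq; pose F j := (x + j%:R * h) / (q + `|x + j%:R * h|).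
apply: (@le_trans _ _ (\sum_(0 <= j < N) 4 * (F j.+1 - F j))).
  apply: ler_sum => j _; rewrite /F.
  have -> : x + j.+1%:R * h = x + j%:R * h + h by rewrite -natr1; ring.
  exact: poisson_le_diff.
rewrite -mulr_sumr telescope_sumr //.
have := abs_sigmoid_le1 (x + N%:R * h) q0.
have := abs_sigmoid_le1 (x + 0%:R * h) q0.
rewrite -/(F N) -/(F 0%N) !ler_norml => /andP[? ?] /andP[? ?]; lra.
Qed.

(** Lets the weight at a point of an edge be replaced by that at its starting vertex. *)
Lemma poisson_shift q t u : 0 < q -> 0 <= t -> 0 <= u -> u <= q + t ->
  q / (q + t) ^+ 2 <= 4 * (q / (q + u) ^+ 2).
Proof.
move=> q0 t0 u0 ut; have p1 : 0 < q + t by lra.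
have p2 : 0 < q + u by lra.
rewrite mulrCA ler_wpM2l ?(ltW q0) // ler_pdivlMr ?exprn_gt0 //.
by rewrite ler_pdivrMl ?exprn_gt0 //; nra.
Qed.

End Telescoping.

(** * The radial function of a convex body around the origin *)

Section RadialFunction.
Context {R : realType}.
Context (K : set (Cplx R)) (rho D : R) (Kv : conv_cplx K) (rho0 : 0 < rho)
  (Krho : forall z, nrm z < rho -> K z) (KD : forall z, K z -> nrm z <= D).
Implicit Types (v z : Cplx R) (s : R).

(** The reciprocal of the Minkowski gauge of [K]. *)
Definition ray_len v : R := sup [set s | 0 <= s /\ K (rc s * v)].

Let K0 : K 0. Proof. by apply: Krho; rewrite nrm0. Qed.

Lemma conv_shrink z s : K z -> 0 <= s <= 1 -> K (rc s * z).
Proof. by move=> Kz s01; have := Kv Kz K0 s01; rewrite mulr0 addr0. Qed.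

Let ray_len_ub v : 1 <= nrm v -> ubound [set s | 0 <= s /\ K (rc s * v)] D.
Proof.
move=> v1 s [s0 /KD]; rewrite nrmM nrm_rc_ge0 //.
by apply: le_trans; rewrite ler_peMr.
Qed.

Let ray_len_has_sup v : 1 <= nrm v -> has_sup [set s | 0 <= s /\ K (rc s * v)].
Proof.
move=> v1; split; first by exists 0; split=> //; rewrite rc0 mul0r.
by exists D; exact: ray_len_ub.
Qed.

Lemma ray_len_ge v s : 1 <= nrm v -> 0 <= s -> K (rc s * v) -> s <= ray_len v.
Proof. by move=> v1 s0 Ks; apply: sup_upper_bound => //; exact: ray_len_has_sup. Qed.

Lemma ray_len_le v : 1 <= nrm v -> ray_len v <= D.
Proof.
move=> v1; apply: ge_sup; last exact: ray_len_ub.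
by exists 0; split=> //; rewrite rc0 mul0r.
Qed.

Lemma ray_len_in v s : 1 <= nrm v -> 0 <= s -> s < ray_len v -> K (rc s * v).
Proof.
move=> v1 s0 /(sup_gt (ray_len_has_sup v1).1)[t [t0 Kt] st].
have tp : 0 < t by exact: le_lt_trans st.
have := @conv_shrink _ (s / t) Kt.
rewrite mulrA -rcM mulfVK ?gt_eqF //; apply.
by rewrite divr_ge0 ?ler_pdivrMr ?mul1r ?(ltW st) ?(ltW tp).
Qed.

Lemma ray_len_ge_third v : 1 <= nrm v <= 2 -> rho / 3 <= ray_len v.
Proof.
move=> /andP[v1 v2]; apply: ray_len_ge => //; first by rewrite divr_ge0 // ltW.
have r3 : 0 <= rho / 3 by rewrite divr_ge0 // ltW.
apply: Krho; rewrite nrmM nrm_rc_ge0 //.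
by have := ler_wpM2l r3 v2; have := rho0; lra.
Qed.

(** If [s * v] is in [K], so is [(1 - ka) * s * v']: it is the convex combination of [s * v] and a
    multiple of [v' - v] that lies in the inner disc. *)
Lemma ray_len_lipschitz v v' : 1 <= nrm v -> 1 <= nrm v' ->
  ray_len v - ray_len v' <= 2 * D ^+ 2 / rho * nrm (v - v').
Proof.
move=> v1 v1'.
have D0 : 0 <= D by exact: le_trans (nrm_ge0 0) (KD K0).
have [->|vv] := eqVneq v v'; first by rewrite !subrr nrm0 mulr0.
have n0 : 0 < nrm (v - v') by rewrite nrm_gt0 subr_eq0.
have r0 w : 1 <= nrm w -> 0 <= ray_len w.
  by move=> w1; apply: ray_len_ge => //; rewrite rc0 mul0r.
have [De|Dp] := eqVneq D 0.
  have := ray_len_le v1; have := r0 v' v1'; rewrite De expr0n mulr0 !mul0r.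
  by lra.
have Dp0 : 0 < D by rewrite lt_def Dp.
(* The weight for which that multiple of [v' - v] has modulus below [rho]. For [ka >= 1] the claim
   follows from [ray_len v <= D]. *)
set ka := 2 * D / rho * nrm (v - v').
have ka0 : 0 < ka by rewrite !mulr_gt0 ?invr_gt0.
have -> : 2 * D ^+ 2 / rho * nrm (v - v') = ka * D by rewrite /ka; ring.
have Rv := ray_len_le v1; have Rv0 := r0 v v1; have Rv0' := r0 v' v1'.
have [k1|k1] := lerP 1 ka; first by nra.
suff : ray_len v * (1 - ka) <= ray_len v' by nra.
rewrite leNgt; apply/negP => H.
have k10 : 0 < 1 - ka by rewrite subr_gt0.
set s := (ray_len v' / (1 - ka) + ray_len v) / 2.
have q0 : 0 <= ray_len v' / (1 - ka) by rewrite divr_ge0 // ltW.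
have qv : ray_len v' / (1 - ka) < ray_len v by rewrite ltr_pdivrMr.
have s0 : 0 <= s by rewrite divr_ge0 ?addr_ge0.
have sv : s < ray_len v by rewrite /s; lra.
have sv' : ray_len v' < s * (1 - ka) by rewrite -ltr_pdivrMr // /s; lra.
suff : s * (1 - ka) <= ray_len v' by rewrite leNgt sv'.
apply: ray_len_ge => //; first by rewrite mulr_ge0 // ltW.
have Ks := ray_len_in v1 s0 sv.
have sD : s * (1 - ka) < 2 * D.
  have : s * (1 - ka) <= s by rewrite ler_piMr //; lra.
  by lra.
have Ky : K (rc (s * (1 - ka) / ka) * (v' - v)).
  have c0 : 0 <= s * (1 - ka) / ka.
    by apply: divr_ge0; [apply: mulr_ge0|]; rewrite ?(ltW k10) ?(ltW ka0).
  apply: Krho; rewrite nrmM nrm_rc_ge0 //.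
  rewrite nrmBC mulrAC ltr_pdivrMr //.
  have -> : rho * ka = 2 * D * nrm (v - v').
    by rewrite /ka; field; rewrite gt_eqF.
  by rewrite ltr_pM2r.
have k01 : 0 <= 1 - ka <= 1 by rewrite (ltW k10) /=; lra.
have := Kv Ks Ky k01.
congr K; rewrite subKr !mulrA -!rcM.
have -> : ka * (s * (1 - ka) / ka) = s * (1 - ka) by field; rewrite gt_eqF.
by rewrite mulrBr [(1 - ka) * s]mulrC; ring.
Qed.

(** If a point [z] of [K] were closer to [zeta], mixing it with a point of the inner disc would put
    [l * zeta] into [K] with [l * mu > 1], beyond the end of the ray. *)
Lemma ray_len_dist v z mu : 1 <= nrm v <= 2 -> 1 < mu -> K z ->
  rho * (mu - 1) <= nrm (z - rc (mu * ray_len v) * v).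
Proof.
move=> v12 mu1 Kz; have /andP[v1 v2] := v12.
rewrite leNgt; apply/negP; set zeta := _ * v => H.
set h := (nrm (z - zeta) + rho * (mu - 1)) / 2.
have nz := nrm_ge0 (z - zeta).
have h0 : 0 < h by rewrite /h; lra.
have h1 : nrm (z - zeta) < h by rewrite /h; lra.
have h2 : h < rho * (mu - 1) by rewrite /h; lra.
pose l := (1 + h / rho)^-1.
have d0 : 0 < 1 + h / rho by rewrite ltr_pwDl // divr_ge0 // ltW.
have l0 : 0 < l by rewrite invr_gt0.
have l1 : l <= 1 by rewrite invf_le1 // lerDl divr_ge0 // ltW.
have Ky : K (rc (rho / h) * (zeta - z)).
  have c0 : 0 <= rho / h by rewrite divr_ge0 // ltW.
  apply: Krho; rewrite nrmM nrm_rc_ge0 // nrmBC.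
  by rewrite mulrAC ltr_pdivrMr // ltr_pM2l.
have l01 : 0 <= l <= 1 by rewrite (ltW l0).
have := Kv Kz Ky l01.
have -> : rc l * z + rc (1 - l) * (rc (rho / h) * (zeta - z)) =
    rc (l * (mu * ray_len v)) * v.
  have -> : rc (1 - l) * (rc (rho / h) * (zeta - z)) = rc l * (zeta - z).
    rewrite mulrA -rcM; congr (rc _ * _).
    by rewrite /l; field; rewrite !gt_eqF // addr_gt0.
  by rewrite (rcM l) -/zeta mulrBr addrC subrK mulrA.
have rv := ray_len_ge_third v12.
have rv0 : 0 < ray_len v by apply: lt_le_trans rv; rewrite divr_gt0.
have mu0 : 0 < mu by lra.
have lm0 : 0 <= l * (mu * ray_len v) by rewrite !mulr_ge0 ?ltW.
move=> /(ray_len_ge v1 lm0).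
rewrite mulrA -[X in _ <= X]mul1r ler_pM2r //.
rewrite /l mulrC ler_pdivrMr // mul1r leNgt => /negP; apply.
rewrite -ltrBrDl ltr_pdivrMr // mulrC; exact: h2.
Qed.

End RadialFunction.

(** * Directions parametrised by a square *)

Section Rays.
Context {R : realType}.
Implicit Types (z : Cplx R) (s t : R) (k : nat).

Definition iC : Cplx R := Complex 0 1.

(** For [k < 4] and [t] from -1 to 1 these are the sides of the square with corners [1 + i],
    [-1 + i], [-1 - i], [1 - i], run through counterclockwise; no angles are involved. *)
Definition ray k t : Cplx R := iC ^+ k * (1 + rc t * iC).

Lemma re_iC : re iC = 0. Proof. by []. Qed.
Lemma im_iC : im iC = 1. Proof. by []. Qed.

Lemma nrm_iC : nrm iC = 1.
Proof.
apply/eqP; rewrite -(@eqrXn2 _ 2) ?nrm_ge0 // nrm_sqr re_iC im_iC.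
by rewrite expr0n add0r !expr1n.
Qed.

Lemma iC_sqr : iC * iC = -1.
Proof. by apply: cplx_eq; rewrite ?reM ?imM ?reN ?imN re_iC im_iC ?re1 ?im1; ring. Qed.

Lemma nrm_ray k t : `|t| <= 1 -> 1 <= nrm (ray k t) <= 2.
Proof.
move=> t1; rewrite /ray nrmM nrmX nrm_iC expr1n mul1r; apply/andP; split.
  by apply: le_trans (re_le _); rewrite reD reM re1 re_rc im_rc re_iC; lra.
by apply: (le_trans (ler_nrmD _ _)); rewrite nrmM nrm1 nrm_iC nrm_rc; lra.
Qed.

Lemma nrm_rayB k t t' : nrm (ray k t - ray k t') = `|t - t'|.
Proof.
have -> : ray k t - ray k t' = iC ^+ k * (rc (t - t') * iC).
  by rewrite /ray rcB; ring.
by rewrite !nrmM nrmX nrm_iC expr1n nrm_rc; ring.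
Qed.

Lemma ray_turn k : ray k 1 = ray k.+1 (-1).
Proof.
rewrite /ray exprSr rcN rc1 -mulrA; congr (_ * _).
have -> : iC * (1 + - 1 * iC) = iC - iC * iC by ring.
by rewrite iC_sqr; ring.
Qed.

Lemma ray4 t : ray 4 t = ray 0 t.
Proof.
rewrite /ray; have -> : iC ^+ 4 = (iC * iC) * (iC * iC) by ring.
by rewrite iC_sqr expr0; ring.
Qed.

Lemma im_ray k t t' : im (ray k t' * cj (ray k t)) = t' - t.
Proof.
rewrite /ray cjM.
have -> : iC ^+ k * (1 + rc t' * iC) * (cj (iC ^+ k) * cj (1 + rc t * iC)) =
  cj (iC ^+ k) * iC ^+ k * ((1 + rc t' * iC) * cj (1 + rc t * iC)) by ring.
rewrite mul_cj nrmX nrm_iC !expr1n rc1 mul1r.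
rewrite imM re_cj im_cj !reD !imD !reM !imM !re_rc !im_rc re_iC im_iC ?re1 ?im1.
by ring.
Qed.

(** After turning side [k] to the right, [t0] is the slope of [z], and the distance to [z] controls
    the difference of slopes. If [z] is not well to the right, all distances are at least [s0 / 2]
    and any [t0] of modulus at most 1 would do. This reduces the weight sum along a side to one real
    variable. *)
Lemma ray_dist k z (s0 : R) : 0 < s0 -> exists t0, forall t s, `|t| <= 1 ->
  s0 <= s -> s0 / 4 * `|t - t0| <= nrm (rc s * ray k t - z).
Proof.
move=> s00; set z' := z / iC ^+ k.
have ik : iC ^+ k != 0 by rewrite expf_neq0 // -nrm_gt0 nrm_iC.
have zE t s : nrm (rc s * ray k t - z) = nrm (rc s * (1 + rc t * iC) - z').
  have -> : rc s * ray k t - z = iC ^+ k * (rc s * (1 + rc t * iC) - z').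
    by rewrite /ray /z'; field.
  by rewrite nrmM nrmX nrm_iC expr1n mul1r.
have reE t s : re (rc s * (1 + rc t * iC) - z') = s - re z'.
  by rewrite reD reM re_rc im_rc reD reM re_rc im_rc re1 re_iC reN; ring.
have imE t s : im (rc s * (1 + rc t * iC) - z') = s * t - im z'.
  by rewrite imD imM re_rc im_rc imD imM re_rc im_rc im1 re_iC im_iC imN; ring.
have [xz|xz] := lerP (s0 / 2) (re z'); last first.
  exists 0 => t s t1 ss; rewrite zE subr0.
  by apply: le_trans (re_le _); rewrite reE; nra.
exists (im z' / re z') => t s t1 ss; rewrite zE.
have x0 : 0 < re z' by apply: lt_le_trans xz; rewrite divr_gt0.
set u := rc s * _ - z'.
have E : `|re z'| * `|t - im z' / re z'| <= 2 * nrm u.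
  rewrite -normrM.
  have -> : re z' * (t - im z' / re z') = im u - t * re u.
    by rewrite /u reE imE; field; rewrite gt_eqF.
  apply: (le_trans (ler_normB _ _)); rewrite normrM.
  have := abs_re_le u; have := abs_im_le u.
  have := normr_ge0 (re u); have := normr_ge0 t; nra.
rewrite gtr0_norm // in E.
have := normr_ge0 (t - im z' / re z'); nra.
Qed.

End Rays.

Section Contour.
Context {R : realType}.
Implicit Types (K : set (Cplx R)) (z : Cplx R).

(* A polygon around [K] with short edges, inside [nu K]; the last bounds hold
   uniformly in [nu], [q] and in the number of edges. *)
Lemma contour K (rho D : R) : conv_cplx K -> 0 < rho ->
  (forall z, nrm z < rho -> K z) -> (forall z, K z -> nrm z <= D) ->
  exists C c0 : R, [/\ 0 < C, 0 < c0 &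
  forall nu q : R, 1 < nu <= 2 -> 0 < q ->
  exists (S : seq (Cplx R * Cplx R)) (tau : R),
  [/\ 0 < tau, tau <= q, closed_chain S,
      forall e, e \in S -> [/\ K (rc nu^-1 * e.1), K (rc nu^-1 * e.2),
        nrm (e.2 - e.1) <= tau, 0 <= im (e.2 * cj e.1) &
        forall x, K x -> 4 * tau <= nrm (x - e.1)] &
  [/\ chain_len S <= C, c0 <= \sum_(e <- S) im (e.2 * cj e.1) &
      forall z, \sum_(e <- S) nrm (e.2 - e.1) *
        (q / (q + nrm (e.1 - z)) ^+ 2) <= C]]].
Proof.
move=> Kv rho0 Krho KD.
have K0 : K 0 by apply: Krho; rewrite nrm0.
have D0 : 0 <= D by exact: le_trans (nrm_ge0 0) (KD _ K0).
pose s v := ray_len K v.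
(* Lipschitz constant in [t] of a side of the contour: [mu <= 2], the ray has modulus at most 2, its
   length is at most [D] with Lipschitz constant [2 * D ^+ 2 / rho]; the 1 makes it positive. *)
pose C1 := 2 * (2 * (2 * D ^+ 2 / rho) + D) + 1.
have L0 : 0 <= 2 * D ^+ 2 / rho by rewrite divr_ge0 ?mulr_ge0 ?exprn_ge0 ?(ltW rho0).
have C10 : 0 < C1 by rewrite /C1; lra.
(* [rho / 3] bounds the ray lengths from below, the quotient by 4 comes from [ray_dist], and
   [c <= 1] gives [c * (q + u) <= q + |zeta - z|]. *)
pose c := Num.min 1 (rho / 3 / 4).
have c0 : 0 < c by rewrite lt_min ltr01 !divr_gt0.
have c1 : c <= 1 by rewrite ge_min lexx.
have c12 : c <= rho / 3 / 4 by rewrite ge_min lexx orbT.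
have c2 : 0 < c ^+ 2 by rewrite exprn_gt0.
exists (8 * C1 + 32 * C1 / c ^+ 2), (8 * (rho / 3) ^+ 2); split.
- by apply: addr_gt0; [apply: mulr_gt0 | apply: divr_gt0 => //; apply: mulr_gt0].
- by rewrite mulr_gt0 // exprn_gt0 // divr_gt0.
move=> nu q /andP[nu1 nu2] q0.
(* The vertices lie on the boundary of [mu K]: off [K] since [mu > 1], within [nu K] since
   [mu < nu]. *)
pose mu := (1 + nu) / 2.
have mu1 : 1 < mu by rewrite /mu; lra.
have mu2 : mu <= 2 by rewrite /mu; lra.
have munu : mu < nu by rewrite /mu; lra.
clearbody mu.
pose tau := Num.min q (rho * (mu - 1) / 4).
have tau0 : 0 < tau by rewrite lt_min q0 divr_gt0 ?mulr_gt0 ?subr_gt0.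
have tauq : tau <= q by rewrite ge_min lexx.
have tau4 : 4 * tau <= rho * (mu - 1).
  have : tau <= rho * (mu - 1) / 4 by rewrite ge_min lexx orbT.
  by lra.
clearbody tau.
have [N N0 [h0 hq hC1 hN]] : exists2 N : nat, (0 < N)%N & let h : R := 2 / N%:R in
    [/\ 0 <= h, h <= q, C1 * h <= tau & N%:R * h = 2].
  (* The first term makes the step at most [q], as the weight sum demands; the second makes the
     edges at most [tau] long. *)
  pose x := 2 / q + 2 * C1 / tau.
  have x0 : 0 <= x.
    by rewrite addr_ge0 ?divr_ge0 ?mulr_ge0 ?(ltW C10) ?(ltW q0) ?(ltW tau0).
  exists (Num.bound x).+1 => //=.
  set M := (Num.bound x).+1; have M0 : 0 < M%:R :> R by rewrite ltr0n.
  have xM : x <= M%:R.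
    by apply/ltW/(lt_le_trans (archi_boundP x0)); rewrite ler_nat.
  have a1 : 2 / q <= M%:R.
    apply: le_trans xM; rewrite lerDl; apply: divr_ge0; last exact: ltW.
    by rewrite mulr_ge0 // ltW.
  have a2 : 2 * C1 / tau <= M%:R.
    by apply: le_trans xM; rewrite lerDr divr_ge0 // ltW.
  split; first by rewrite divr_ge0 // ltW.
  - by rewrite ler_pdivrMr // mulrC -ler_pdivrMr.
  - by rewrite mulrA ler_pdivrMr // [C1 * 2]mulrC [tau * _]mulrC -ler_pdivrMr.
  - by rewrite mulrC mulfVK // gt_eqF.
move: h0 hq hC1 hN; set h : R := 2 / N%:R => h0 hq hC1 hN.
clearbody h.
pose t (j : nat) : R := -1 + j%:R * h.
have t_abs j : (j <= N)%N -> `|t j| <= 1.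
  move=> jN; have : j%:R * h <= 2 by rewrite -hN ler_wpM2r // ler_nat.
  have : 0 <= j%:R * h by rewrite mulr_ge0.
  by rewrite ler_norml /t => a b; apply/andP; split; lra.
have tS j : t j.+1 - t j = h by rewrite /t -natr1; ring.
pose zeta k x := rc (mu * s (ray k x)) * ray k x.
have zdist k x z : `|x| <= 1 -> K z -> 4 * tau <= nrm (z - zeta k x).
  move=> /(nrm_ray k) rx Kz; apply: (le_trans tau4).
  exact: (ray_len_dist Kv rho0 Krho KD rx mu1 Kz).
have znu k x : `|x| <= 1 -> K (rc nu^-1 * zeta k x).
  move=> /(nrm_ray k) rx; have rx1 := rx; case/andP: rx1 => rx1 _.
  rewrite /zeta mulrA -rcM.
  have sp : 0 < s (ray k x).
    by apply: lt_le_trans (ray_len_ge_third rho0 Krho KD rx); rewrite divr_gt0.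
  have nu0 : 0 < nu by lra.
  apply: (ray_len_in Kv rho0 Krho KD rx1).
    by apply: mulr_ge0; [rewrite invr_ge0 ltW | rewrite mulr_ge0 // ltW //; lra].
  by rewrite ltr_pdivrMl // ltr_pM2r.
have zlip k x y : `|x| <= 1 -> `|y| <= 1 ->
    nrm (zeta k y - zeta k x) <= C1 * `|y - x|.
  move=> /(nrm_ray k) rx /(nrm_ray k) ry.
  have /andP[rx1 _] := rx; have /andP[ry1 ry2] := ry.
  have -> : zeta k y - zeta k x =
      rc mu * (rc (s (ray k y) - s (ray k x)) * ray k y +
               rc (s (ray k x)) * (ray k y - ray k x)).
    by rewrite /zeta !rcM rcB; ring.
  have yx := normr_ge0 (y - x).
  have sx0 : 0 <= s (ray k x).
    by apply: le_trans (ray_len_ge_third rho0 Krho KD rx); rewrite divr_ge0 // ltW.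
  have sxD : s (ray k x) <= D by exact: (ray_len_le rho0 Krho KD rx1).
  have ds : `|s (ray k y) - s (ray k x)| <= 2 * D ^+ 2 / rho * `|y - x|.
    have := ray_len_lipschitz Kv rho0 Krho KD rx1 ry1.
    have := ray_len_lipschitz Kv rho0 Krho KD ry1 rx1.
    rewrite !nrm_rayB (distrC x) -/(s _) -/(s _) ler_norml => a b.
    by apply/andP; split; lra.
  rewrite nrmM nrm_rc_ge0; last by lra.
  have H : nrm (rc (s (ray k y) - s (ray k x)) * ray k y +
      rc (s (ray k x)) * (ray k y - ray k x)) <=
      (2 * (2 * D ^+ 2 / rho) + D) * `|y - x|.
    apply: (le_trans (ler_nrmD _ _)).
    rewrite (nrmM (rc (_ - _))) (nrmM (rc (s _))) !nrm_rc nrm_rayB.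
    rewrite (ger0_norm sx0) mulrDl; apply: lerD; last by rewrite ler_wpM2r.
    rewrite [X in X <= _]mulrC -[X in _ <= X]mulrA.
    by apply: ler_pM; rewrite ?nrm_ge0 ?normr_ge0.
  have n0 := nrm_ge0 (rc (s (ray k y) - s (ray k x)) * ray k y +
               rc (s (ray k x)) * (ray k y - ray k x)).
  apply: (le_trans (ler_pM _ n0 mu2 H)); first by lra.
  by rewrite /C1; move: (2 * (2 * D ^+ 2 / rho) + D) => X; lra.
have zedge k j : (j < N)%N -> nrm (zeta k (t j.+1) - zeta k (t j)) <= C1 * h.
  move=> jN; have := zlip k _ _ (t_abs j (ltnW jN)) (t_abs j.+1 jN).
  by rewrite tS ger0_norm.
have zim k j : (j < N)%N ->
    (rho / 3) ^+ 2 * h <= im (zeta k (t j.+1) * cj (zeta k (t j))).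
  move=> jN; rewrite /zeta.
  have rx := nrm_ray k (t_abs j (ltnW jN)); have ry := nrm_ray k (t_abs j.+1 jN).
  have sx := ray_len_ge_third rho0 Krho KD rx.
  have sy := ray_len_ge_third rho0 Krho KD ry.
  rewrite -/(s _) in sx; rewrite -/(s _) in sy.
  set a := mu * s _; set b := mu * s _.
  have -> : rc a * ray k (t j.+1) * cj (rc b * ray k (t j)) =
      rc (a * b) * (ray k (t j.+1) * cj (ray k (t j))).
    by rewrite cjM cj_rc rcM; ring.
  rewrite imM re_rc im_rc mul0r addr0 im_ray tS ler_wpM2r //.
  have r3 : 0 <= rho / 3 by rewrite divr_ge0 // ltW.
  have ra : rho / 3 <= a by rewrite /a; nra.
  have rb : rho / 3 <= b by rewrite /b; nra.
  by rewrite expr2 ler_pM.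
pose S := [seq (zeta k (t j), zeta k (t j.+1)) |
  k <- index_iota 0 4, j <- index_iota 0 N].
have sumS (V : nmodType) (F : Cplx R * Cplx R -> V) : \sum_(e <- S) F e =
    \sum_(0 <= k < 4) \sum_(0 <= j < N) F (zeta k (t j), zeta k (t j.+1)).
  by rewrite /S big_allpairs_dep.
have inS e : e \in S -> exists k j, (j < N)%N /\ e = (zeta k (t j), zeta k (t j.+1)).
  case/allpairsP => -[k j] /= [_]; rewrite mem_index_iota => /andP[_ jN] ->.
  by exists k, j.
have zend k : zeta k (t N) = zeta k.+1 (t 0%N).
  rewrite /zeta /t mul0r addr0 hN.
  have -> : -1 + 2 = 1 :> R by ring.
  by rewrite ray_turn.
have const_sum (x : R) : \sum_(0 <= k < 4) \sum_(0 <= j < N) x * h = 8 * x.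
  transitivity (4 * x * (N%:R * h)); last by rewrite hN; ring.
  by rewrite !sumr_const_nat !subn0 -mulrnA -[LHS]mulr_natl natrM; ring.
exists S, tau; split => //.
- move=> A; rewrite sumS.
  (* A side ends where the next one starts, and after four quarter turns the first side returns. *)
  have inner k : \sum_(0 <= j < N) (A (zeta k (t j.+1)) - A (zeta k (t j))) =
      A (zeta k.+1 (t 0%N)) - A (zeta k (t 0%N)).
    by rewrite (telescope_sumr (fun j => A (zeta k (t j)))) // zend.
  under eq_bigr do rewrite inner.
  rewrite (telescope_sumr (fun k => A (zeta k (t 0%N)))) //.
  have -> : zeta 4 (t 0%N) = zeta 0%N (t 0%N) by rewrite /zeta ray4.
  by rewrite subrr.
- move=> e /inS[k [j [jN ->]]] /=; split.
  + by apply: znu; apply: t_abs; exact: ltnW.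
  + by apply: znu; exact: t_abs.
  + by apply: le_trans hC1; exact: zedge.
  + by apply: le_trans (zim k j jN); rewrite mulr_ge0 ?exprn_ge0 ?divr_ge0 ?(ltW rho0).
  + by move=> x; apply: zdist; apply: t_abs; exact: ltnW.
have t32 : 0 <= 32 * C1 / c ^+ 2.
  by apply: divr_ge0; [apply: mulr_ge0 => //; exact: ltW | exact: ltW].
have C8 : 0 <= 8 * C1 by apply: mulr_ge0 => //; exact: ltW.
split.
- rewrite /chain_len sumS.
  apply: (@le_trans _ _ (\sum_(0 <= k < 4) \sum_(0 <= j < N) C1 * h)).
    apply: ler_sum_nat => k _; apply: ler_sum_nat => j /= jN; exact: zedge.
  by rewrite const_sum; lra.
- rewrite sumS.
  apply: (@le_trans _ _ (\sum_(0 <= k < 4) \sum_(0 <= j < N) (rho / 3) ^+ 2 * h)).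
    by rewrite const_sum.
  apply: ler_sum_nat => k _; apply: ler_sum_nat => j /= jN; exact: zim.
- move=> z; rewrite sumS.
  suff kb k : \sum_(0 <= j < N) nrm (zeta k (t j.+1) - zeta k (t j)) *
      (q / (q + nrm (zeta k (t j) - z)) ^+ 2) <= 8 * C1 / c ^+ 2.
    apply: (@le_trans _ _ (\sum_(0 <= k < 4) 8 * C1 / c ^+ 2)).
      by apply: ler_sum => k _; exact: kb.
    rewrite sumr_const_nat subn0 -[X in X <= _]mulr_natl.
    have -> : 4%:R * (8 * C1 / c ^+ 2) = 32 * C1 / c ^+ 2 by ring.
    by rewrite lerDr.
  have r30 : 0 < rho / 3 by rewrite divr_gt0.
  have [t0 t0P] := ray_dist k z r30.
  apply: (@le_trans _ _ (C1 / c ^+ 2 *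
      \sum_(0 <= j < N) h * (q / (q + `|(-1 - t0) + j%:R * h|) ^+ 2))).
    rewrite mulr_sumr; apply: ler_sum_nat => j /= jN.
    have -> : -1 - t0 + j%:R * h = t j - t0 by rewrite /t; ring.
    set u := `|t j - t0|; have u0 : 0 <= u by exact: normr_ge0.
    have zu : c * u <= nrm (zeta k (t j) - z).
      apply: (@le_trans _ _ (rho / 3 / 4 * u)); first by rewrite ler_wpM2r.
      have tj := t_abs j (ltnW jN); apply: t0P => //.
      have := ray_len_ge_third rho0 Krho KD (nrm_ray k tj); rewrite -/(s _).
      move=> sge; apply: (le_trans sge); rewrite ler_peMl ?(ltW mu1) //.
      exact: le_trans (ltW r30) sge.
    have qu : 0 < q + u by lra.
    have -> : C1 / c ^+ 2 * (h * (q / (q + u) ^+ 2)) =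
        C1 * h * (q / (c * (q + u)) ^+ 2).
      by rewrite exprMn; field; rewrite !gt_eqF.
    have cq : c * q <= q by rewrite ler_piMl // ltW.
    have cqu : c * (q + u) <= q + nrm (zeta k (t j) - z) by rewrite mulrDr lerD.
    have cqu0 : 0 < c * (q + u) by rewrite mulr_gt0.
    apply: ler_pM; [exact: nrm_ge0| |exact: zedge|].
      by rewrite divr_ge0 ?exprn_ge0 ?addr_ge0 ?nrm_ge0 // ltW.
    rewrite ler_wpM2l ?(ltW q0) // lef_pV2 ?posrE ?exprn_gt0 //; last first.
      exact: lt_le_trans cqu.
    by rewrite lerXn2r // nnegrE; [exact: ltW | exact: le_trans (ltW cqu0) cqu].
  have H := @sum_poisson_le R q h (-1 - t0) N q0 h0 hq.
  have CC : 0 <= C1 / c ^+ 2 by rewrite divr_ge0 ?(ltW C10) // ltW.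
  apply: (le_trans (ler_wpM2l CC H)).
  by rewrite le_eqVlt; apply/orP; left; apply/eqP; ring.
Qed.

End Contour.

(** * Interior approximation *)

Section Dilation.
Context {R : realType}.
Implicit Types (K L : set (Cplx R)) (z : Cplx R) (g : Cplx R -> Cplx R).

Definition cont_on K g := forall z, K z -> forall e : R, 0 < e ->
  exists2 r : R, 0 < r & forall y, K y -> nrm (y - z) < r -> nrm (g y - g z) <= e.

Lemma compact_dilate K (nu : R) : 0 < nu -> compact K ->
  compact [set x | K (rc nu^-1 * x)].
Proof.
move=> nu0 Kc.
have -> : [set x | K (rc nu^-1 * x)] = (fun x => rc nu * x) @` K.
  rewrite predeqE => x; split=> /= [Kx|[y Ky <-]].
    exists (rc nu^-1 * x) => //.
    by rewrite mulrA -rcM mulfV ?gt_eqF // rc1 mul1r.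
  by rewrite mulrA -rcM mulVf ?gt_eqF // rc1 mul1r.
apply: continuous_compact => //; apply: continuous_subspaceT => x A.
move=> /nbhs_nrmP[d d0 dA]; apply/nbhs_nrmP; exists (d / nu) => [|y].
  by rewrite divr_gt0.
rewrite ltr_pdivlMr // => yx; apply: dA.
by rewrite -mulrBr nrmM nrm_rc_ge0 ?(ltW nu0) // mulrC.
Qed.

Lemma dilate_uniform K g (D : R) : compact K -> conv_cplx K -> K 0 ->
  (forall z, K z -> nrm z <= D) -> cont_on K g -> forall e : R, 0 < e ->
  exists eta : R, [/\ 0 < eta, eta <= 1 / 2 &
    forall z, K z -> nrm (g (rc (1 - eta) * z) - g z) <= e].
Proof.
move=> Kc Kv K0 KD gc e e0.
have D0 : 0 <= D by exact: le_trans (nrm_ge0 0) (KD _ K0).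
have [||n nP] := @compact_nat_uniform _ K (fun n z => forall eta : R,
    0 <= eta -> eta <= n.+2%:R^-1 -> nrm (g (rc (1 - eta) * z) - g z) <= e) Kc.
- move=> i j z ij H eta eta0 /le_trans etaj; apply: H => //; apply: etaj.
  by rewrite lef_pV2 ?posrE ?ltr0n // ler_nat !ltnS.
- move=> z Kz; have e20 : 0 < e / 2 by rewrite divr_gt0.
  have [r r0 rP] := gc z Kz _ e20.
  have Dr : 0 <= 2 * D / r by rewrite divr_ge0 ?mulr_ge0 // ltW.
  exists (Num.bound (2 * D / r)); exists (r / 2); first by rewrite divr_gt0.
  move=> y Ky yz eta eta0 /= etan.
  set N : R := (Num.bound (2 * D / r)).+2%:R in etan; have N0 : 0 < N by rewrite ltr0n.
  have eta1 : eta <= 1.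
    by apply: (le_trans etan); rewrite invf_le1 // ler1n.
  have DN : 2 * D / r < N by apply: (lt_le_trans (archi_boundP Dr)); rewrite ler_nat ltnW.
  have etaD : eta * D < r / 2.
    have H : N^-1 * D < r / 2.
      by rewrite mulrC ltr_pdivrMr //; move: DN; rewrite ltr_pdivrMr // => DN; lra.
    by apply: le_lt_trans H; rewrite ler_wpM2r.
  have Kl : K (rc (1 - eta) * y).
    have := Kv y 0 (1 - eta) Ky K0; rewrite mulr0 addr0; apply.
    by apply/andP; split; lra.
  have H1 : nrm (rc (1 - eta) * y - z) < r.
    have -> : rc (1 - eta) * y - z = (y - z) - rc eta * y by rewrite rcB rc1; ring.
    apply: (le_lt_trans (ler_nrmB _ _)); rewrite nrmM nrm_rc_ge0 //.
    have : eta * nrm y <= eta * D by rewrite ler_wpM2l // KD.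
    lra.
  have H2 : nrm (y - z) < r by lra.
  have := nrm_tri (g (rc (1 - eta) * y)) (g z) (g y).
  rewrite (nrmBC (g z)).
  by have := rP _ Kl H1; have := rP _ Ky H2; lra.
- exists n.+2%:R^-1; split; first by rewrite invr_gt0 ltr0n.
    by rewrite mul1r lef_pV2 ?posrE ?ltr0n // ler_nat.
  by move=> z Kz; apply: nP => //; rewrite invr_ge0.
Qed.

(** Shrinking towards the centre by [ka] frees a ball of [ka] times the inner radius. *)
Lemma conv_ball K (rho ka : R) z y : conv_cplx K -> 0 < rho ->
  (forall z, nrm z < rho -> K z) -> K z -> 0 < ka <= 1 ->
  nrm (y - rc (1 - ka) * z) < ka * rho -> K y.
Proof.
move=> Kv rho0 Krho Kz /andP[ka0 ka1] yz.
have Kw : K (rc ka^-1 * (y - rc (1 - ka) * z)).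
  apply: Krho; rewrite nrmM nrm_rc_ge0 ?invr_ge0 ?(ltW ka0) //.
  by rewrite ltr_pdivrMl.
have := Kv _ _ (1 - ka) Kz Kw; rewrite subKr mulrA -rcM mulfV ?gt_eqF // rc1.
have -> : rc (1 - ka) * z + 1 * (y - rc (1 - ka) * z) = y by ring.
by apply; apply/andP; split; lra.
Qed.

End Dilation.

Section Core.
Context {R : realType}.
Implicit Types (K L : set (Cplx R)) (z : Cplx R) (g : Cplx R -> Cplx R).

(** A trapezoid sum is a finite linear combination of its values with coefficients independent of
    [z], so [kp] may depend on the node in any way. *)
Lemma edgeint_poly (S : seq (Cplx R * Cplx R)) (kp : Cplx R -> {poly Cplx R})
    (N m : nat) : (forall x, (size (kp x) <= N)%N) ->
  exists2 Q : {poly Cplx R}, (size Q <= N)%N &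
    forall z, Q.[z] = edgeint m S (fun x => (kp x).[z]).
Proof.
move=> kN.
have seg a b : exists2 Q : {poly Cplx R}, (size Q <= N)%N &
    forall z, Q.[z] = segint m a b (fun x => (kp x).[z]).
  elim: m a b => [|m IH] a b /=.
    exists (((b - a) / 2) *: (kp a + kp b)) => [|z].
      apply: (leq_trans (size_scale_leq _ _)).
      by apply: (leq_trans (size_polyD _ _)); rewrite geq_max !kN.
    by rewrite hornerZ hornerD; ring.
  have [Q1 s1 E1] := IH a ((a + b) / 2); have [Q2 s2 E2] := IH ((a + b) / 2) b.
  exists (Q1 + Q2) => [|z]; last by rewrite hornerD E1 E2.
  by apply: (leq_trans (size_polyD _ _)); rewrite geq_max s1.
elim: S => [|e S [Q sQ EQ]].
  by exists 0 => [|z]; rewrite ?size_poly0 // horner0 /edgeint big_nil.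
have [Q1 s1 E1] := seg e.1 e.2.
exists (Q1 + Q) => [|z]; last by rewrite hornerD E1 EQ /edgeint big_cons.
by apply: (leq_trans (size_polyD _ _)); rewrite geq_max s1.
Qed.

(** [C] and [a] are fixed before [g], [M] and [k]; without this the corrections for different
    degrees could not share one near-best constant. *)
Lemma interior_approx K (rho D : R) : compact K -> conv_cplx K -> 0 < rho ->
  (forall z, nrm z < rho -> K z) -> (forall z, K z -> nrm z <= D) ->
  exists C a : R, [/\ 0 < C, 0 < a, a * D <= 1 &
  forall g (M : R), 0 < M -> cont_on K g -> (forall z, K° z -> cdiff g z) ->
  (forall z, K z -> nrm (g z) <= M) -> forall k, (0 < k)%N ->
  exists Q : {poly Cplx R}, [/\ (size Q <= 4 * k)%N,
    forall z, K z -> nrm Q.[z] <= C * M &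
    forall z (d : R), 0 < d <= D -> (forall y, nrm (y - z) <= d -> K y) ->
      nrm (g z - Q.[z]) <= C * M * (2 ^- k + (1 - a * d / 2) ^+ k / d)]].
Proof.
move=> Kc Kv rho0 Krho KD.
have K0 : K 0 by apply: Krho; rewrite nrm0.
have Kne : K !=set0 by exists 0.
have D0 : 0 < D.
  apply: (@lt_le_trans _ _ (rho / 2)); first by rewrite divr_gt0.
  rewrite -[X in X <= _](@nrm_rc_ge0 R); last by rewrite divr_ge0 // ltW.
  by apply: KD; apply: Krho; rewrite nrm_rc_ge0; lra.
have [Cc [c0 [Cc0 c00 contourP]]] := contour Kv rho0 Krho KD.
(* Points of [K] and of [nu K] are at most [4 * D] apart, so the modulus [a] for [al] keeps
   [al * (z - x)] in the disc of radius [1 / 4]. *)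
pose a : R := (16 * D)^-1.
have a0 : 0 < a by rewrite invr_gt0 mulr_gt0.
have aD : a * (16 * D) = 1 by rewrite mulVf // gt_eqF // mulr_gt0.
clearbody a.
pose C2 := 12 * a + 4 / rho + 4 * (3 / a + D * (1 + D / rho)).
have Drho : 0 <= D / rho by rewrite divr_ge0 // ltW.
have C20 : 0 < C2.
  have : 0 < 4 / rho by rewrite divr_gt0.
  have : 0 < 3 / a by rewrite divr_gt0.
  have : 0 <= D * (1 + D / rho) by apply: mulr_ge0; [exact: ltW|lra].
  by rewrite /C2; lra.
have C2E : 12 * a + 4 / rho + 4 * (3 / a + D * (1 + D / rho)) = C2 by [].
clearbody C2.
(* Lower bound for the winding sum: the area bound of the contour, whose points have modulus at most
   [2 * D]. *)
pose s0 := c0 / (2 * D) ^+ 2.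
have s00 : 0 < s0 by rewrite divr_gt0 // exprn_gt0 // mulr_gt0.
have is0 : 0 < s0^-1 by rewrite invr_gt0.
(* The first term pays for the kernel error on [K], the last for the one inside. The 2 covers the
   value of [g] and the small errors on [K], and inside [K] the errors of dilation and of Cauchy's
   formula. *)
pose C := 4 * C2 * Cc / s0 + 2 + Cc / s0.
have q1 : 0 < 4 * C2 * Cc / s0 by rewrite divr_gt0 // mulr_gt0 // mulr_gt0.
have q2 : 0 < Cc / s0 by rewrite divr_gt0.
have s0E : c0 / (2 * D) ^+ 2 = s0 by [].
clearbody s0.
have C0 : 0 < C by rewrite /C; lra.
have C_ge2 : 2 <= C by rewrite /C; lra.
have C_ge1 : 4 * C2 * Cc / s0 + 2 <= C by rewrite /C lerDl ltW.
have C_ge : Cc / s0 <= C by rewrite /C lerDr addr_ge0 ?(ltW q1).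
clearbody C.
exists C, a; split => //; first by lra.
move=> g M M0 gc gd gM k k0.
pose eps : R := 2 ^- k; have eps0 : 0 < eps by rewrite invr_gt0 exprn_gt0.
have eps1 : eps <= 1 by rewrite invf_le1 ?exprn_gt0 // exprn_ege1 // ler1n.
have epsE : 2 ^- k = eps by [].
clearbody eps.
have epsM0 : 0 < eps * M by rewrite mulr_gt0.
have [eta [eta0 eta1 etaP]] := dilate_uniform Kc Kv K0 KD gc epsM0.
(* The contour runs in [nu K] and [g] is evaluated at [la * x]. Since [la * nu = 1 - eta ^+ 2 < 1],
   these arguments keep a ball of radius [eta ^+ 2 * rho] in [K]. *)
pose la := 1 - eta; pose nu := 1 + eta.
have nu1 : 1 < nu <= 2 by rewrite /nu; apply/andP; split; lra.
have nu0 : 0 < nu by rewrite ltr_pwDl // ltW.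
have kap : la * nu = 1 - eta ^+ 2 by rewrite /la /nu; ring.
have eta2 : 0 < eta ^+ 2 <= 1.
  by rewrite exprn_gt0 //= exprn_ile1 //; lra.
pose L := [set x : Cplx R | K (rc nu^-1 * x)].
have Lc : compact L by exact: compact_dilate.
have Km : midclosed K by exact: midclosed_conv.
have Lm : midclosed L.
  move=> x y Lx Ly; rewrite /L /=.
  have -> : rc nu^-1 * ((x + y) / 2) = (rc nu^-1 * x + rc nu^-1 * y) / 2 by ring.
  exact: Km.
have KL : K `<=` L.
  move=> z Kz; have := Kv z 0 nu^-1 Kz K0; rewrite mulr0 addr0; apply.
  by rewrite invr_ge0 (ltW nu0) invf_le1 // /nu lerDl ltW.
have LD x : L x -> nrm x <= 2 * D.
  move=> /KD; rewrite nrmM nrm_rc_ge0 ?invr_ge0 ?(ltW nu0) // ler_pdivrMl //.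
  have /andP[_ n2] := nu1; move=> /le_trans; apply; rewrite ler_wpM2r //.
  exact: ltW.
have LK x y : L x -> nrm (y - rc la * x) < eta ^+ 2 * rho -> K y.
  move=> Lx yx; apply: (conv_ball Kv rho0 Krho Lx eta2).
  rewrite mulrA -rcM -kap mulfK ?gt_eqF //.
pose h x := g (rc la * x).
have hd p : L p -> cdiff h p.
  move=> Lp; apply: cdiff_dilate.
    by rewrite rc_eq0 gt_eqF // /la; lra.
  apply: gd; apply/interior_nrmP; exists (eta ^+ 2 * rho).
    by rewrite mulr_gt0 // exprn_gt0.
  by move=> y; exact: LK.
have hM p : L p -> nrm (h p) <= M.
  by move=> Lp; apply: gM; apply: (LK p) => //; rewrite subrr nrm0 mulr_gt0 // exprn_gt0.
pose q : R := k%:R^-1.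
have q0 : 0 < q by rewrite invr_gt0 ltr0n.
have q1' : q <= 1 by rewrite invf_le1 ?ltr0n // ler1n.
have [S [tau [tau0 tauq Sc Se [Slen Sarea Ssum]]]] := contourP nu q nu1 q0.
pose P (e : Cplx R * Cplx R) := L `&` [set x | nrm (x - e.1) <= tau].
have SP (Q : Cplx R * Cplx R -> Cplx R -> Prop) :
    (forall e x, e \in S -> L x -> nrm (x - e.1) <= tau ->
      (forall z, K z -> 3 * tau <= nrm (x - z)) -> Q e x) -> on_edges S Q.
  move=> HQ e eS; have [e1 e2 e12 _ eK] := Se e eS.
  exists (P e); split.
  - by apply: midclosedI => //; exact: midclosed_ball.
  - by split=> //=; rewrite subrr nrm0 ltW.
  - by split.
  move=> x [Lx xe]; apply: HQ => // z Kz.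
  have := eK z Kz; have := nrm_tri z x e.1; rewrite (nrmBC z x).
  by move: xe => /=; lra.
have t30 : 0 < 3 * tau by rewrite mulr_gt0.
have SLK : on_edges S (fun _ x => L x /\ forall z, K z -> 3 * tau <= nrm (x - z)).
  by apply: SP.
have Sw e : e \in S -> exists w, exists2 s : R, 0 < s & forall z, K z ->
    s + re (w * z) <= re (w * e.1) /\ s + re (w * z) <= re (w * e.2).
  move=> eS; have [_ _ e12 _ eK] := Se e eS.
  have t40 : 0 < 4 * tau by rewrite mulr_gt0.
  have [w w1 wP] := separation Kc Kv Kne t40 eK.
  by exists w; exists (3 * tau) => // z Kz; apply: separation_edge (wP z Kz).
(* Division by the winding sum, at least [s0] in modulus, leaves [eps * M]. *)
pose eps1' := s0 * eps * M; have e10 : 0 < eps1' by rewrite mulr_gt0 // mulr_gt0.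
have [m mP] := cauchy_uniform Lc Lm Kc Km KL K0 KD hd Sc t30 SLK Sw e10.
have {mP} mP := mP m (leqnn m).
set sig := edgeint m S (fun x => x^-1) in mP.
have sig0 : s0 <= nrm sig.
  apply: le_trans (im_le _).
  apply: le_trans (@im_edgeint_inv R S (2 * D) m _ _).
  - by rewrite -mulr_suml -s0E ler_wpM2r // invr_ge0 exprn_ge0 // mulr_ge0 // ltW.
  - apply: SP => e x _ Lx _ xK; rewrite LD // andbT.
    by have := xK 0 K0; rewrite subr0; exact: lt_le_trans.
  - by move=> e /Se[].
have sign : 0 < nrm sig by exact: lt_le_trans sig0.
have sigz : sig != 0 by rewrite -nrm_gt0.
have isig : (nrm sig)^-1 <= s0^-1 by rewrite lef_pV2.
(* A supporting direction for each outer point, with the dummy [0] elsewhere. It may jump with [x],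
   because only finite sums are formed. *)
have [W WP] := @choice _ _ (fun x w => (forall z, K z -> 3 * tau <= nrm (z - x)) ->
    nrm w = 1 /\ forall z, K z -> re (w * (z - x)) <= - (3 * tau))
  (fun x => match pselect (forall z, K z -> 3 * tau <= nrm (z - x)) with
    | left H => let: ex_intro2 w w1 wP := separation Kc Kv Kne t30 H in
        ex_intro _ w (fun _ => conj w1 wP)
    | right H => ex_intro _ 0 (fun H' => False_ind _ (H H'))
    end).
pose al x := rc a * W x.
have [Q1 sQ1 EQ1] := @edgeint_poly S (fun x => h x *: kernel_poly k (al x) x)
   (4 * k) m (fun x => leq_trans (size_scale_leq _ _) (size_kernel_poly k (al x) x)).
have alP x z : L x -> (forall z, K z -> 3 * tau <= nrm (x - z)) -> K z ->
    [/\ nrm (al x) = a, nrm (al x * (z - x)) <= 1 / 4 &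
        re (al x * (z - x)) = a * re (W x * (z - x))].
  move=> Lx xK Kz.
  have [|W1 _] := WP x; first by move=> y Ky; rewrite nrmBC xK.
  have nal : nrm (al x) = a by rewrite nrmM W1 mulr1 nrm_rc_ge0 // ltW.
  split=> //; last by rewrite -mulrA reM re_rc im_rc mul0r subr0.
  rewrite nrmM nal; have zx : nrm (z - x) <= 4 * D.
    have -> : 4 * D = 2 * D + 2 * D by ring.
    apply: (le_trans (ler_nrmB _ _)); apply: lerD; last exact: LD.
    by apply: (le_trans (KD z Kz)); rewrite ler_peMl ?(ltW D0) // ler1n.
  apply: (le_trans (ler_wpM2l (ltW a0) zx)).
  have -> : a * (4 * D) = (a * (16 * D)) / 4 by field.
  by rewrite aD.
have Qsplit z z0 : Q1.[z] =
    edgeint m S (fun x => h x * ((kernel_poly k (al x) x).[z] - (x - z0)^-1)) +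
    edgeint m S (fun x => h x / (x - z0)).
  rewrite EQ1 -edgeintD; congr edgeint; apply/funext => x.
  by rewrite hornerZ; ring.
exists (sig^-1 *: Q1); split.
- exact: leq_trans (size_scale_leq _ _) sQ1.
- move=> z Kz; pose z0 := rc (1 - q) * z.
  have Kz0 : K z0.
    have := Kv z 0 (1 - q) Kz K0; rewrite mulr0 addr0; apply.
    by rewrite subr_ge0 q1' gerBl ltW.
  have zz0 : nrm (z - z0) <= q * D.
    have -> : z - z0 = rc q * z by rewrite /z0 rcB rc1; ring.
    by rewrite nrmM nrm_rc_ge0 ?(ltW q0) // ler_wpM2l ?(ltW q0) // KD.
  (* The ball of radius [q * rho] about [z0 = (1 - q) * z] lies in [K], while nodes of the contour
     do not. *)
  have z0K x : (forall z, K z -> 3 * tau <= nrm (x - z)) ->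
      rho * q <= nrm (x - z0).
    move=> xK; rewrite leNgt; apply/negP => H.
    have Kx : K x.
      apply: (conv_ball Kv rho0 Krho Kz (ka := q)); first by rewrite q0.
      by rewrite [q * rho]mulrC.
    by have := xK x Kx; rewrite subrr nrm0 leNgt t30.
  have B1 : nrm (edgeint m S (fun x => h x *
       ((kernel_poly k (al x) x).[z] - (x - z0)^-1))) <= 4 * C2 * Cc * M.
    apply: le_trans (@ler_edgeint R S (fun e => (4 * C2 * M) *
        (q / (q + nrm (e.1 - z)) ^+ 2)) _ m _) _.
      apply: SP => e x eS Lx xe xK; rewrite nrmM.
      have [W1 W2] : nrm (W x) = 1 /\ forall z, K z -> re (W x * (z - x)) <= - (3 * tau).
        by apply: WP => y Ky; rewrite nrmBC xK.
      have [al1 al2 al3] := alP x z Lx xK Kz.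
      have xr : re (al x * (z - x)) <= 0.
        rewrite al3 pmulr_rle0 //; apply: (le_trans (W2 z Kz)).
        by rewrite oppr_le0 ltW.
      have := kernel_compare k0 a0 rho0 D0 al1 xr al2 zz0 (z0K x xK).
      rewrite C2E -/q => H.
      have w : q / (q + nrm (x - z)) ^+ 2 <= 4 * (q / (q + nrm (e.1 - z)) ^+ 2).
        apply: poisson_shift; rewrite ?nrm_ge0 //.
        apply: (le_trans (nrm_tri _ x _)); rewrite lerD2r nrmBC.
        exact: le_trans xe tauq.
      have -> : 4 * C2 * M * (q / (q + nrm (e.1 - z)) ^+ 2) =
         M * (C2 * (4 * (q / (q + nrm (e.1 - z)) ^+ 2))) by ring.
      apply: ler_pM; rewrite ?nrm_ge0 ?hM //.
      by apply: (le_trans H); rewrite ler_wpM2l // ltW.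
    under eq_bigr do rewrite mulrCA.
    rewrite -mulr_sumr.
    have -> : 4 * C2 * Cc * M = 4 * C2 * M * Cc by ring.
    by apply: ler_wpM2l => //; rewrite !mulr_ge0 // ltW.
  have B2 := mP z0 Kz0.
  have hz0 := hM z0 (KL _ Kz0).
  rewrite hornerZ nrmM nrmV (Qsplit z z0).
  set E1 := edgeint _ _ _ in B1 *; set E2 := edgeint _ _ _ in B2 *.
  have H : nrm (E1 + E2) <= 4 * C2 * Cc * M + eps1' + M * nrm sig.
    have -> : E1 + E2 = E1 + (E2 - h z0 * sig) + h z0 * sig by ring.
    apply: (le_trans (ler_nrmD _ _)); apply: lerD.
      by apply: (le_trans (ler_nrmD _ _)); exact: lerD.
    by rewrite nrmM ler_wpM2r ?nrm_ge0.
  have isg0 : 0 <= (nrm sig)^-1 by rewrite invr_ge0 nrm_ge0.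
  apply: (le_trans (ler_wpM2l isg0 H)); rewrite mulrDr.
  have -> : (nrm sig)^-1 * (M * nrm sig) = M by field; rewrite gt_eqF.
  have A0 : 0 <= 4 * C2 * Cc * M + eps1'.
    by apply: addr_ge0; [rewrite !mulr_ge0 // ltW | exact: ltW].
  have A1 := ler_wpM2r A0 isig.
  have A2 : s0^-1 * (4 * C2 * Cc * M + eps1') = (4 * C2 * Cc / s0 + eps) * M.
    by rewrite /eps1'; field; rewrite gt_eqF.
  rewrite A2 in A1.
  have A3 : (4 * C2 * Cc / s0 + eps) * M + M <= C * M.
    rewrite -[X in _ + X <= _]mul1r -mulrDl ler_wpM2r ?(ltW M0) //.
    by apply: le_trans C_ge1; rewrite -addrA lerD2l; lra.
  by apply: le_trans A3; rewrite lerD2r.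
- move=> z d /andP[d0 dD] zd.
  have Kz : K z by apply: zd; rewrite subrr nrm0 ltW.
  have ad0 : 0 < a * d by rewrite mulr_gt0.
  have adD : a * d <= a * D by rewrite ler_wpM2l // ltW.
  have ad1 : a * d <= 1.
    by rewrite (le_trans adD) // -aD ler_wpM2l ?(ltW a0) // ler_peMl ?ler1n // ltW.
  pose th := (1 - a * d / 2) ^+ k.
  have th0 : 0 <= th.
    rewrite exprn_ge0 // subr_ge0 ler_pdivrMr // mul1r.
    by rewrite (le_trans ad1) // ler1n.
  have B1 : nrm (edgeint m S (fun x => h x *
       ((kernel_poly k (al x) x).[z] - (x - z)^-1))) <= Cc * (M * (th / d)).
    apply: le_trans (@ler_edgeint_cst R S (M * (th / d)) _ m _) _.
      apply: SP => e x eS Lx xe xK; rewrite nrmM.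
      have [W1 W2] : nrm (W x) = 1 /\ forall z, K z -> re (W x * (z - x)) <= - (3 * tau).
        by apply: WP => y Ky; rewrite nrmBC xK.
      have [al1 al2 al3] := alP x z Lx xK Kz.
      have Wd : re (W x * (z - x)) <= - d.
        (* The supporting inequality at the point of the ball about [z] farthest in direction [W x]
           yields the margin [d] at [z] itself. *)
        pose y := z + rc d * cj (W x).
        have Ky : K y.
          apply: zd; rewrite /y addrC addKr nrmM nrm_cj W1 mulr1 nrm_rc_ge0 //.
          exact: ltW.
        have := W2 y Ky.
        have -> : W x * (y - x) = W x * (z - x) + rc d * (cj (W x) * W x).
          by rewrite /y; ring.
        rewrite mul_cj W1 expr1n rc1 mulr1 reD re_rc => Wy.
        rewrite -[X in X <= _](addrK d) lerBlDr addNr (le_trans Wy) //.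
        by rewrite oppr_le0 ltW.
      have al0 : al x != 0 by rewrite -nrm_gt0 al1.
      have xr : re (al x * (z - x)) <= - (a * d).
        by rewrite al3 -mulrN ler_wpM2l // ltW.
      have := kernel_exp_close k0 al0 ad0 ad1 xr al2; rewrite al1 -/th.
      have -> : a / (a * d) * th = th / d by field; rewrite !gt_eqF.
      by move=> H; apply: ler_pM; rewrite ?nrm_ge0 ?hM.
    by apply: ler_wpM2r => //; rewrite mulr_ge0 ?divr_ge0 // ltW.
  have B2 := mP z Kz.
  have B3 : nrm (h z - g z) <= eps * M by exact: etaP.
  rewrite hornerZ (Qsplit z z).
  set E1 := edgeint _ _ _ in B1 *; set E2 := edgeint _ _ _ in B2 *.
  have -> : g z - sig^-1 * (E1 + E2) =
      - (h z - g z) - sig^-1 * (E1 + (E2 - h z * sig)) by field.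
  apply: (le_trans (ler_nrmB _ _)); rewrite nrmN nrmM nrmV.
  have H : nrm (E1 + (E2 - h z * sig)) <= Cc * (M * (th / d)) + eps1'.
    by apply: (le_trans (ler_nrmD _ _)); exact: lerD.
  have isg0 : 0 <= (nrm sig)^-1 by rewrite invr_ge0 nrm_ge0.
  have A1 := ler_pM isg0 (nrm_ge0 _) isig H.
  have A2 : s0^-1 * (Cc * (M * (th / d)) + eps1') =
      Cc / s0 * (M * (th / d)) + eps * M.
    by rewrite /eps1'; field; rewrite !gt_eqF.
  rewrite A2 in A1; apply: (le_trans (lerD B3 A1)).
  have -> : C * M * (2 ^- k + (1 - a * d / 2) ^+ k / d) =
      C * (eps * M) + C * (M * (th / d)) by rewrite epsE /th; ring.
  have x0 : 0 <= M * (th / d) by rewrite mulr_ge0 ?divr_ge0 // ltW.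
  have y0 : 2 * (eps * M) <= C * (eps * M).
    by apply: ler_wpM2r; first exact: ltW.
  have w0 : Cc / s0 * (M * (th / d)) <= C * (M * (th / d)).
    exact: ler_wpM2r.
  apply: le_trans (lerD y0 w0).
  by rewrite mulrDl mul1r -!addrA lerD2l addrC.
Qed.

End Core.

(** * Near-best polynomials *)

Section Interface.
Context {R : realType}.
Implicit Types (K X : set (Cplx R)) (z : Cplx R) (f g : Cplx R -> Cplx R).

Lemma convex_in_C_conv K : convex_in_C K -> conv_cplx K.
Proof.
move=> Kv a b t Ka Kb /andP[t0 t1].
have := Kv a b (Itv01 t0 t1); rewrite !in_setE => /(_ Ka Kb).
congr K; apply: cplx_eq; rewrite ?reD ?imD ?reM ?imM ?re_rc ?im_rc.
  by case: (a) (b) => u v [u' v'] /=; rewrite /unstable.onem; ring.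
by case: (a) (b) => u v [u' v'] /=; rewrite /unstable.onem; ring.
Qed.

Lemma within_cont_on K f : {within K, continuous f} -> cont_on K f.
Proof.
move=> /subspace_continuousP fK z Kz e e0.
have /cvgrPdist_le/(_ (rc e)) := fK z Kz.
rewrite -rc0 lt_rc => /(_ e0) /nbhs_nrmP[d d0 dP].
exists d => // y Ky yz; have := dP y yz Ky.
by rewrite normE le_rc nrmBC.
Qed.

Lemma cont_on_bounded K g : compact K -> cont_on K g ->
  exists2 B : R, 0 < B & forall z, K z -> nrm (g z) <= B.
Proof.
move=> Kc gc; apply: (@locally_bounded_compact _ K g) => // z Kz.
have [r r0 rP] := gc z Kz 1 ltr01.
exists (1 + nrm (g z)); exists r => // y Ky /(rP y Ky) H.
have -> : g y = (g y - g z) + g z by ring.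
by apply: (le_trans (ler_nrmD _ _)); rewrite lerD2r.
Qed.

Lemma cont_on_subpoly K f (P : {poly Cplx R}) : cont_on K f ->
  cont_on K (fun z => f z - P.[z]).
Proof.
move=> fc z Kz e e0; have e20 : 0 < e / 2 by rewrite divr_gt0.
have [r r0 rP] := fc z Kz _ e20.
have [s s0 sP] := cdiff_cont (cdiff_horner P z) e20.
exists (Num.min r s); first by rewrite lt_min r0.
move=> y Ky; rewrite lt_min => /andP[/(rP y Ky) H1 /sP H2].
have -> : f y - P.[y] - (f z - P.[z]) = (f y - f z) - (P.[y] - P.[z]) by ring.
by apply: (le_trans (ler_nrmB _ _)); lra.
Qed.

Lemma supnorm_le X g (B : R) : 0 <= B -> (forall z, X z -> nrm (g z) <= B) ->
  supnorm X g <= B.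
Proof.
move=> B0 gB; have [X0|/set0P[x Xx]] := eqVneq X set0.
  by rewrite /supnorm X0 image_set0 sup0.
apply: ge_sup; first by exists (nrm (g x)); exists x.
by move=> _ [z Xz <-]; exact: gB.
Qed.

Lemma le_supnorm X g (B : R) : (forall z, X z -> nrm (g z) <= B) ->
  forall z, X z -> nrm (g z) <= supnorm X g.
Proof.
move=> gB z Xz; apply: sup_upper_bound; last by exists z.
by split; [exists (nrm (g z)); exists z | exists B => _ [y Xy <-]; exact: gB].
Qed.

Lemma supnorm_ge0 X g : 0 <= supnorm X g.
Proof.
have [[[y [x Xx _]] [B BP]]|nsup] := pselect (has_sup [set nrm (g z) | z in X]).
  apply: le_trans (nrm_ge0 (g x)) _; apply: (@le_supnorm _ _ B) => // z Xz.
  by apply: BP; exists z.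
by rewrite /supnorm sup_out.
Qed.

Lemma best_approx_ge0 K f n : 0 <= best_approx K f n.
Proof.
apply: lb_le_inf; last by move=> _ [P _ <-]; exact: supnorm_ge0.
by exists (supnorm K (fun z => f z - (0 : {poly Cplx R}).[z])); exists 0 => //=;
  rewrite /poly_deg_le /= size_poly0.
Qed.

Lemma best_approx_lb K f n (P : {poly Cplx R}) : (size P <= n.+1)%N ->
  best_approx K f n <= supnorm K (fun z => f z - P.[z]).
Proof.
move=> sP; apply: ge_inf; last by exists P.
by exists 0 => _ [Q _ <-]; exact: supnorm_ge0.
Qed.

Lemma best_approx_lt K f n (x : R) : best_approx K f n < x ->
  exists2 P : {poly Cplx R}, (size P <= n.+1)%N &
    supnorm K (fun z => f z - P.[z]) < x.
Proof.
move=> /inf_lt[]; last by move=> _ [P sP <-] Px; exists P.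
by exists (supnorm K (fun z => f z - (0 : {poly Cplx R}).[z])); exists 0 => //=;
  rewrite /poly_deg_le /= size_poly0.
Qed.

(* When the distance vanishes, [f] is the Lagrange interpolant at any [n + 1]
   points of [K], because interpolation is continuous in the data. *)
Lemma best_approx_eq0 K f n : compact K -> cont_on K f -> K° !=set0 ->
  best_approx K f n = 0 ->
  exists2 P : {poly Cplx R}, (size P <= n.+1)%N & forall z, K z -> f z = P.[z].
Proof.
move=> Kc fc [z0 /interior_nrmP[d d0 dP]] E0.
pose x (i : nat) := z0 + rc (d / i.+2%:R).
have x_inj : injective x.
  move=> i j /addrI/rc_inj/(mulfI (lt0r_neq0 d0))/invr_inj/eqP.
  by rewrite eqr_nat => /eqP[].
have Kx i : K (x i).
  apply: dP; rewrite /x addrC addKr nrm_rc_ge0 ?divr_ge0 ?(ltW d0) //.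
  by rewrite ltr_pdivrMr ?ltr0n // ltr_pMr // ltr1n.
pose ell (i : 'I_n.+1) : {poly Cplx R} := tnth (lagrange n.+1 x) i.
pose P := \sum_(i < n.+1) (f (x i))%:P * ell i.
have sP : (size P <= n.+1)%N.
  apply: (leq_trans (size_sum _ _ _)); apply/bigmax_leqP => i _.
  rewrite mul_polyC; apply: (leq_trans (size_scale_leq _ _)).
  by rewrite /ell size_lagrange_.
exists P => // z Kz; apply/eqP; rewrite -subr_eq0 -nrm_eq0.
pose Lam := \sum_(i < n.+1) nrm (ell i).[z].
have Lam0 : 0 <= Lam by apply: sumr_ge0 => i _; exact: nrm_ge0.
rewrite eq_le nrm_ge0 andbT; apply/ler_addgt0Pr => e e0; rewrite add0r.
have e1 : 0 < e / (1 + Lam) by rewrite divr_gt0 // ltr_pwDl.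
have [Q sQ QK] : exists2 Q : {poly Cplx R}, (size Q <= n.+1)%N &
    supnorm K (fun z => f z - Q.[z]) < e / (1 + Lam).
  by apply: best_approx_lt; rewrite E0.
have [B _ BP] := cont_on_bounded Kc (cont_on_subpoly Q fc).
have fQ y : K y -> nrm (f y - Q.[y]) <= e / (1 + Lam).
  by move=> Ky; apply: le_trans (ltW QK); exact: (le_supnorm BP Ky).
have -> : f z - P.[z] = (f z - Q.[z]) - \sum_(i < n.+1) (f (x i) - Q.[x i]) * (ell i).[z].
  have EP : P.[z] = \sum_(i < n.+1) f (x i) * (ell i).[z].
    by rewrite horner_sum; apply: eq_bigr => i _; rewrite hornerM hornerC.
  have EQ : Q.[z] = \sum_(i < n.+1) Q.[x i] * (ell i).[z].
    rewrite {1}(lagrange_gen (ltn0Sn _) x_inj sQ) horner_sum.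
    by apply: eq_bigr => i _; rewrite hornerM hornerC.
  rewrite (eq_bigr (fun i : 'I_n.+1 => f (x i) * (ell i).[z] - Q.[x i] * (ell i).[z])).
    by rewrite sumrB -EP -EQ; ring.
  by move=> i _; rewrite mulrBl.
apply: (le_trans (ler_nrmB _ _)).
have H : nrm (\sum_(i < n.+1) (f (x i) - Q.[x i]) * (ell i).[z]) <= e / (1 + Lam) * Lam.
  apply: (le_trans (nrm_sum _ _)); rewrite mulr_sumr; apply: ler_sum => i _.
  by rewrite nrmM ler_wpM2r ?nrm_ge0 // fQ.
have := fQ z Kz.
have eE : e = e / (1 + Lam) + e / (1 + Lam) * Lam.
  by field; rewrite gt_eqF // ltr_pwDl.
move=> H'; rewrite [X in _ <= X]eE; exact: lerD.
Qed.

(** The factor 2 leaves room above a positive infimum; only for distance zero must the infimum be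
    attained. *)
Lemma near_best_exists K f n : compact K -> cont_on K f -> K° !=set0 ->
  exists2 P : {poly Cplx R}, (size P <= n.+1)%N &
    supnorm K (fun z => f z - P.[z]) <= 2 * best_approx K f n.
Proof.
move=> Kc fc Ki; have [E0|E0] := eqVneq (best_approx K f n) 0.
  have [P sP PK] := best_approx_eq0 Kc fc Ki E0.
  exists P => //; rewrite E0 mulr0; apply: supnorm_le => // z /PK ->.
  by rewrite subrr nrm0.
have Ep : 0 < best_approx K f n by rewrite lt_def E0 best_approx_ge0.
have [|P sP PK] := @best_approx_lt K f n (2 * best_approx K f n); first by lra.
by exists P => //; exact: ltW.
Qed.

Lemma interior_approx_at K : compact K -> conv_cplx K -> K° !=set0 ->
  exists C a D : R, [/\ 0 < C, 0 < a, 0 < D, a * D <= 1 &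
  forall g (M : R), 0 < M -> cont_on K g -> (forall z, K° z -> cdiff g z) ->
  (forall z, K z -> nrm (g z) <= M) -> forall k, (0 < k)%N ->
  exists Q : {poly Cplx R}, [/\ (size Q <= 4 * k)%N,
    forall z, K z -> nrm Q.[z] <= C * M &
    forall z (d : R), 0 < d <= D -> (forall y, nrm (y - z) <= d -> K y) ->
      nrm (g z - Q.[z]) <= C * M * (2 ^- k + (1 - a * d / 2) ^+ k / d)]].
Proof.
move=> Kc Kv [z0 /interior_nrmP[rho rho0 rhoP]].
pose K' := [set x : Cplx R | K (x + z0)].
have K'c : compact K'.
  have -> : K' = (fun x => x - z0) @` K.
    rewrite predeqE => x; split=> [Kx|[y Ky <-]]; last by rewrite /K' /= subrK.
    by exists (x + z0) => //; rewrite addrK.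
  apply: continuous_compact => //; apply: continuous_subspaceT => x A.
  move=> /nbhs_nrmP[d d0 dA]; apply/nbhs_nrmP; exists d => // y yx; apply: dA.
  by have -> : y - z0 - (x - z0) = y - x by ring.
have K'v : conv_cplx K'.
  move=> x y t Kx Ky t01; rewrite /K' /=.
  have -> : rc t * x + rc (1 - t) * y + z0 =
      rc t * (x + z0) + rc (1 - t) * (y + z0) by rewrite rcB rc1; ring.
  exact: Kv.
have K'rho z : nrm z < rho -> K' z by move=> zr; apply: rhoP; rewrite addrK.
have [D D0 DP] : exists2 D : R, 0 < D & forall z, K' z -> nrm z <= D.
  apply: (@locally_bounded_compact _ K' id) => // z _.
  exists (1 + nrm z); exists 1 => // y _ yz.
  have -> : y = (y - z) + z by ring.
  by apply: (le_trans (ler_nrmD _ _)); rewrite lerD2r ltW.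
have [C [a [C0 a0 aD H]]] := interior_approx K'c K'v rho0 K'rho DP.
exists C, a, D; split => // g M M0 gc gd gM k k0.
have [||z K'z|Q [sQ QK QE]] := H (fun x => g (x + z0)) M M0 _ _ _ k k0.
- move=> z Kz e e0; have [r r0 rP] := gc _ Kz e e0.
  exists r => // y Ky yz; apply: rP => //.
  by have -> : y + z0 - (z + z0) = y - z by ring.
- move=> z /interior_nrmP[d d0 dP].
  have [|l lP] := gd (z + z0).
    apply/interior_nrmP; exists d => // y yz.
    have -> : y = (y - z0) + z0 by ring.
    by apply: dP; have -> : y - z0 - z = y - (z + z0) by ring.
  exists l => e e0; have [r r0 rP] := lP e e0; exists r => // y yz.
  have e1 : y + z0 - (z + z0) = y - z by ring.
  by have := rP (y + z0); rewrite e1; exact.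
- exact: gM.
- exists (Q \Po ('X - z0%:P)); split.
  + by rewrite size_comp_poly2 // size_XsubC.
  + move=> z Kz; rewrite horner_comp !hornerE; apply: QK.
    by rewrite /K' /= subrK.
  + move=> z d d0D zd; rewrite horner_comp !hornerE.
    have := QE (z - z0) d d0D; rewrite subrK; apply => y yz.
    by apply: zd; have -> : y + z0 - z = y - (z - z0) by ring.
Qed.

End Interface.

(** * From exponential decay to the limit superior *)

Section Limit.
Context {R : realType}.

(** The decay rate is twice that of the weight, so the product tends to zero instead of merely
    staying bounded. *)
Lemma limn_esup_expR_decay (u : nat -> R) (A c : R) : 0 < c ->
  (forall n, 0 <= u n <= A * expR (- (2 * c * n%:R))) ->
  limn_esup (fun n => (u n * expR (c * n%:R))%:E) = 0%E.
Proof.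
move=> c0 uA.
have cv : (fun n => u n * expR (c * n%:R)) @ \oo --> (0 : R).
  apply: (@squeeze_cvgr _ _ _ _ (fun=> 0) (fun n => A * expR (- c) ^+ n)).
  - near=> n; have /andP[u0 un] := uA n.
    rewrite mulr_ge0 ?expR_ge0 //=.
    apply: (le_trans (ler_wpM2r (expR_ge0 _) un)).
    rewrite -[X in X <= _]mulrA -expRD -expRM_natr.
    have -> : - (2 * c * n%:R) + c * n%:R = - c * n%:R by ring.
    exact: lexx.
  - exact: cvg_cst.
  - rewrite -[X in _ --> X](mulr0 A); apply: cvgM; first exact: cvg_cst.
    by apply: cvg_expr; rewrite ger0_norm ?expR_ge0 // expR_lt1 oppr_lt0.
have cvE : (fun n => (u n * expR (c * n%:R))%:E) @ \oo --> 0%E.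
  by apply: cvg_EFin; [near=> n|exact: cv].
rewrite is_cvg_limn_esupE; last by apply/cvg_ex; exists 0%E.
exact: cvg_lim.
Unshelve. all: by end_near.
Qed.

End Limit.

(** * Correction of near-best polynomials and the rate on compact subsets *)

Section Final.
Context {R : realType}.
Implicit Types (K E : set (Cplx R)) (f : Cplx R -> Cplx R).

Lemma corrected_near_best K f : compact K -> conv_cplx K -> K° !=set0 ->
  cont_on K f -> (forall z, K° z -> cdiff f z) ->
  exists C a D : R, [/\ 1 < C, 0 < a, 0 < D, a * D <= 1 &
  forall n, exists P : {poly Cplx R}, [/\ (size P <= n.+1)%N,
    supnorm K (fun z => f z - P.[z]) <= C * best_approx K f n &
    forall z (d : R), 0 < d <= D -> (forall y, nrm (y - z) <= d -> K y) ->
      nrm (f z - P.[z]) <= C * best_approx K f n *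
        (2 ^- (n %/ 4) + (1 - a * d / 2) ^+ (n %/ 4) / d)]].
Proof.
move=> Kc Kv Ki fc fd.
have [C [a [D [C0 a0 D0 aD H]]]] := interior_approx_at Kc Kv Ki.
exists (2 * (C + 1)), a, D; split => //; first by lra.
move=> n; set k := (n %/ 4)%N; set E := best_approx K f n.
have E0 : 0 <= E by exact: best_approx_ge0.
have [P sP PE] := near_best_exists n Kc fc Ki.
rewrite -/E in PE; pose g z := f z - P.[z]; pose M := supnorm K g.
have ME : M <= 2 * E by exact: PE.
have gc : cont_on K g by exact: cont_on_subpoly.
have [B B0 BP] := cont_on_bounded Kc gc.
have gM z : K z -> nrm (g z) <= M by exact: (le_supnorm BP).
have CE : 2 * E <= 2 * (C + 1) * E.
  by rewrite -mulrA ler_wpM2l // ler_peMl //; lra.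
(* The correction requires [M > 0] and [k > 0]. Otherwise [P] itself serves: its error vanishes on
   [K], or [k = 0] and the factor [1 + d^-1] is at least 1. *)
have [M0|k0] := boolP ((M <= 0) || (k == 0)%N).
  exists P; split => //; first exact: le_trans CE.
  move=> z d /andP[d0 dD] zd; have Kz : K z by apply: zd; rewrite subrr nrm0 ltW.
  have ad : a * d <= 1 by apply: le_trans aD; rewrite ler_wpM2l // ltW.
  have ad0 : 0 < a * d by rewrite mulr_gt0.
  have id0 : 0 <= d^-1 by rewrite invr_ge0 ltW.
  have CE0 : 0 <= 2 * (C + 1) * E by apply: le_trans CE; rewrite mulr_ge0.
  apply: (le_trans (gM z Kz)); case/orP: M0 => [M0|/eqP ->].
    apply: (le_trans M0); apply: mulr_ge0 => //.
    by rewrite addr_ge0 ?invr_ge0 ?exprn_ge0 ?mulr_ge0 // exprn_ge0 //; lra.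
  rewrite !expr0 invr1 mul1r; apply: (le_trans ME); apply: (le_trans CE).
  by rewrite ler_peMr // lerDl.
move: k0; rewrite negb_or -ltNge -lt0n => /andP[M0 k0].
have gd z : K° z -> cdiff g z.
  by move=> /fd fz; exact: cdiffB fz (cdiff_horner P z).
have [Q [sQ QK QE]] := H g M M0 gc gd gM k k0.
have CM : (C + 1) * M <= 2 * (C + 1) * E.
  have -> : 2 * (C + 1) * E = (C + 1) * (2 * E) by ring.
  by rewrite ler_wpM2l //; lra.
have fPQ z : f z - (P + Q).[z] = g z - Q.[z] by rewrite hornerD /g; ring.
exists (P + Q); split.
- apply: (leq_trans (size_polyD _ _)); rewrite geq_max sP (leq_trans sQ) //.
  by rewrite mulnC; apply: leq_trans (leq_trunc_div _ _) _.
- apply: le_trans CM; apply: supnorm_le => [|z Kz].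
    by apply: mulr_ge0; [lra|exact: ltW].
  rewrite fPQ; apply: (le_trans (ler_nrmB _ _)).
  by have := gM z Kz; have := QK z Kz; lra.
- move=> z d d0D zd; have /andP[d0 dD] := d0D.
  have ad : a * d <= 1 by apply: le_trans aD; rewrite ler_wpM2l // ltW.
  have ad0 : 0 < a * d by rewrite mulr_gt0.
  rewrite fPQ; apply: (le_trans (QE z d d0D zd)); apply: ler_wpM2r.
    apply: addr_ge0; first by rewrite invr_ge0 exprn_ge0.
    by apply: divr_ge0; [apply: exprn_ge0; lra | exact: ltW].
  by apply: le_trans CM; rewrite mulrDl lerDl mul1r ltW.
Qed.

Lemma compact_interior_margin K E (D : R) : compact E -> E `<=` K° -> 0 < D ->
  exists2 d : R, 0 < d <= D & forall z, E z -> forall y, nrm (y - z) <= d -> K y.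
Proof.
move=> Ec EK D0.
have [||n nP] := @compact_nat_uniform _ E (fun n z => forall y,
    nrm (y - z) <= n.+1%:R^-1 -> K y) Ec.
- move=> i j z ij H y yz; apply: H; apply: (le_trans yz).
  by rewrite lef_pV2 ?posrE ?ltr0n // ler_nat ltnS.
- move=> z /EK/interior_nrmP[r r0 rP].
  have ir : 0 <= 2 / r by rewrite divr_ge0 // ltW.
  exists (Num.bound (2 / r)); exists (r / 2); first by rewrite divr_gt0.
  move=> x Ex xz y yx; apply: rP.
  have : (Num.bound (2 / r)).+1%:R^-1 <= r / 2.
    rewrite -[X in _ <= X]invrK lef_pV2 ?posrE ?invr_gt0 ?ltr0n ?divr_gt0 //.
    rewrite invf_div; apply/ltW/(lt_le_trans (archi_boundP ir)).
    by rewrite ler_nat.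
  move=> h1; apply: (le_lt_trans (nrm_tri y x z)).
  by have := le_trans yx h1; lra.
- exists (Num.min D n.+1%:R^-1).
    by rewrite lt_min D0 invr_gt0 ltr0n /= ge_min lexx.
  move=> z Ez y yz; apply: (nP z Ez); apply: (le_trans yz).
  by rewrite ge_min lexx orbT.
Qed.

(** From [n <= 4 * (n %/ 4) + 3]: the first factor is [th] to the power [-3/4], the second [th] to
    the power [n/4]. *)
Lemma exprn_div4_le (th : R) n : 0 < th < 1 ->
  th ^+ (n %/ 4) <= expR (- (3 / 4 * ln th)) * expR (- (2 * (- ln th / 8) * n%:R)).
Proof.
move=> /andP[th0 th1]; have l0 : ln th < 0 by rewrite ln_lt0 ?th0.
rewrite -{1}[th]lnK ?posrE // -expRM_natr -expRD ler_expR.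
have : (n <= 4 * (n %/ 4) + 3)%N by lia.
rewrite -(ler_nat R) natrD natrM; move: (n%:R) ((n %/ 4)%:R) => x y; nra.
Qed.

End Final.

Theorem theorem1 (R : realType) (K : set (Cplx R)) (K_compact : compact K)
    (K_convex : convex_in_C K) (K_int : K° !=set0)
    (f : Cplx R -> Cplx R) (f_A : in_A K f) :
  exists p : nat -> {poly Cplx R}, near_best K f p /\
    forall E : set (Cplx R), compact E -> E `<=` K° ->
      exists c : R, 0 < c /\
        limn_esup (fun n : nat =>
          (supnorm E (fun z => f z - (p n).[z]) * expR (c * n%:R))%:E) = 0%E.
Proof.
have [/within_cont_on fc fd] := f_A.
have fd' z : K° z -> cdiff f z by move=> /fd/cdiffP.
have Kv := convex_in_C_conv K_convex.
have [C [a [D [C1 a0 D0 aD H]]]] := corrected_near_best K_compact Kv K_int fc fd'.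
have [p pP] := choice H.
exists p; split.
  split; first by move=> n _; have [] := pP n.
  by exists C; split => // n _; have [] := pP n.
move=> E Ec EK; have [d d0D dK] := compact_interior_margin Ec EK D0.
have /andP[d0 dD] := d0D.
have ad1 : a * d <= 1 by apply: le_trans aD; rewrite ler_wpM2l // ltW.
have ad0 : 0 < a * d by rewrite mulr_gt0.
pose th := 1 - a * d / 2.
have th1 : 0 < th < 1 by rewrite /th; apply/andP; split; lra.
have /andP[th0 th_lt1] := th1.
(* The error of the zero polynomial bounds the best approximation of every degree; all the decay
   comes from the power of [th]. *)
pose E0 := supnorm K (fun z => f z - (0 : {poly Cplx R}).[z]).
have E00 : 0 <= E0 by exact: supnorm_ge0.
pose A := C * E0 * (1 + d^-1).
have id0 : 0 <= d^-1 by rewrite invr_ge0 ltW.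
have C0 : 0 <= C by lra.
have A0 : 0 <= A by rewrite /A !mulr_ge0 // addr_ge0.
(* Half of the rate [- ln th / 4] that degree [n] gives through the power [n %/ 4]. *)
exists (- ln th / 8); split.
  by rewrite divr_gt0 // oppr_gt0 ln_lt0 // th0.
apply: (@limn_esup_expR_decay _ _ (A * expR (- (3 / 4 * ln th)))).
  by rewrite divr_gt0 // oppr_gt0 ln_lt0 // th0.
move=> n; rewrite supnorm_ge0 /= -mulrA.
apply: (@le_trans _ _ (A * th ^+ (n %/ 4))); last first.
  by rewrite ler_wpM2l // exprn_div4_le.
apply: supnorm_le => [|z Ez]; first by rewrite mulr_ge0 // exprn_ge0 // ltW.
have [_ _ pE] := pP n.
have En0 : 0 <= best_approx K f n by exact: best_approx_ge0.
have EnE : best_approx K f n <= E0 by apply: best_approx_lb; rewrite size_poly0.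
(* Since [a * d <= 1], [th] is at least [1 / 2]. *)
have half : 2 ^- (n %/ 4) <= th ^+ (n %/ 4).
  rewrite -exprVn lerXn2r ?nnegrE ?invr_ge0 //; first exact: ltW.
  by rewrite /th; lra.
apply: (le_trans (pE z d d0D (dK z Ez))); rewrite -/th.
have -> : A * th ^+ (n %/ 4) =
    C * E0 * (th ^+ (n %/ 4) + th ^+ (n %/ 4) / d) by rewrite /A; ring.
have t0 : 0 <= th ^+ (n %/ 4) by rewrite exprn_ge0 // ltW.
apply: ler_pM; rewrite ?mulr_ge0 ?addr_ge0 ?invr_ge0 ?exprn_ge0 ?mulr_ge0 ?(ltW d0) //.
  by rewrite ler_wpM2l.
by rewrite lerD2r.
Qed.
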